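(* Let $\mathfrak{X}=(X,\{R_i\}_{i=0}^3)$ be a commutative nonsymmetric association scheme of class $3$ with $R_1^\top=R_2$ and $R_3$ symmetric, and let $A_0=I,A_1,A_2,A_3$ be its adjacency matrices (so $A_1^\top=A_2$ and $A_3$ is symmetric). Let $w_0=1$ and let $w_1,w_2,w_3$ be complex numbers of absolute value $1$, and put $W=w_0A_0+w_1A_1+w_2A_2+w_3A_3$. Assume that $W$ is a hermitian complex Hadamard matrix and is not a real Hadamard matrix. Then $\mathfrak{X}$ is a nonsymmetric association scheme whose unique nontrivial symmetric relation $R_3$ consists of $2a$ cliques of size $2a$ for some positive integer $a$, and (for a suitable ordering of the primitive idempotents, with columns indexed by $A_0,A_1,A_2,A_3$) the first eigenmatrix of $\mathfrak{X}$ is \[ \begin{pmatrix} 1&a(2a-1)&a(2a-1)&2a-1\\ 1&ai&-ai&-1\\ 1&-ai&ai&-1\\ 1&-a&-a&2a-1 \end{pmatrix}, \] where $i=\sqrt{-1}$. Moreover, $w_1=\pm i$ and $w_3=1$.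
   Context: A complex Hadamard matrix of order $n$ is an $n\times n$ matrix $W$ all of whose entries have absolute value $1$ and which satisfies $W\overline{W}^\top=nI$; it is a real Hadamard matrix if in addition all entries are real. The first eigenmatrix $P=(P_{k,j})$ of a commutative association scheme with primitive idempotents $E_0=\frac1nJ,E_1,\dots,E_d$ is defined by $A_j=\sum_k P_{k,j}E_k$. ''$R_3$ consists of $2a$ cliques of size $2a$'' means the graph with edge set $R_3$ is a disjoint union of $2a$ complete graphs on $2a$ vertices. *)

(* Defs.v *)
From HB Require Import structures.
From mathcomp Require Import all_boot all_order all_algebra.
From mathcomp Require Import reals complex.

Set Implicit Arguments.
Unset Strict Implicit.
Unset Printing Implicit Defensive.

Import Order.TTheory GRing.Theory Num.Theory.
Local Open Scope ring_scope.
Local Open Scope sesquilinear_scope.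

(* The relations partition X * X into nonempty parts, so the intersection
   numbers [inter_num i j k] = p_{ij}^k are determined by the relations. *)
Record assoc_scheme (X : finType) (d : nat) := AssocScheme {
  scheme_rel :> 'I_d.+1 -> rel X;
  inter_num : 'I_d.+1 -> 'I_d.+1 -> 'I_d.+1 -> nat;
  scheme_diag : forall x y, scheme_rel ord0 x y = (x == y);
  scheme_nonempty : forall k, exists x y, scheme_rel k x y;
  scheme_cover : forall x y, exists k, scheme_rel k x y;
  scheme_disjoint : forall k l x y,
    scheme_rel k x y -> scheme_rel l x y -> k = l;
  scheme_transpose : forall k, exists l,
    forall x y, scheme_rel l x y = scheme_rel k y x;
  scheme_inter : forall i j k x y, scheme_rel k x y ->
    #|[set z | scheme_rel i x z && scheme_rel j z y]| = inter_num i j k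
}.

Definition commutative_scheme X d (S : assoc_scheme X d) : Prop :=
  forall i j k, inter_num S i j k = inter_num S j i k.

Definition symmetric_scheme X d (S : assoc_scheme X d) : Prop :=
  forall k, symmetric (S k).

Definition disjoint_cliques (X : finType) (e : rel X) (m s : nat) : Prop :=
  exists P : {set {set X}},
    [/\ partition P [set: X], #|P| = m, forall B, B \in P -> #|B| = s &
        forall x y, e x y = (x != y) && (pblock P x == pblock P y)].

Section BoseMesner.
Variables (C : numClosedFieldType) (X : finType) (d : nat).
Variable S : assoc_scheme X d.

Definition adj (k : 'I_d.+1) : 'M[C]_#|X| :=
  \matrix_(x, y) (S k (enum_val x) (enum_val y))%:R.

Definition in_bose_mesner (M : 'M[C]_#|X|) : Prop :=
  exists c : 'I_d.+1 -> C, M = \sum_k c k *: adj k.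

Definition bm_idempotent (M : 'M[C]_#|X|) : Prop :=
  in_bose_mesner M /\ M *m M = M.

Definition bm_primitive_idempotent (M : 'M[C]_#|X|) : Prop :=
  [/\ bm_idempotent M, M != 0 &
      forall F G, bm_idempotent F -> bm_idempotent G ->
        F *m G = 0 -> G *m F = 0 -> M = F + G -> F = 0 \/ G = 0].

Definition primitive_idempotents (E : 'I_d.+1 -> 'M[C]_#|X|) : Prop :=
  [/\ injective E,
      forall M, bm_primitive_idempotent M <-> exists k, M = E k &
      E ord0 = #|X|%:R^-1 *: const_mx 1].

Definition first_eigenmatrix (E : 'I_d.+1 -> 'M[C]_#|X|) (P : 'M[C]_d.+1) :
    Prop :=
  forall j, adj j = \sum_k P k j *: E k.

End BoseMesner.

Definition complex_hadamard (C : numClosedFieldType) n (W : 'M[C]_n) : Prop :=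
  (forall i j, `|W i j| = 1) /\ W *m W^t* = n%:R%:M.

Definition real_hadamard (C : numClosedFieldType) n (W : 'M[C]_n) : Prop :=
  complex_hadamard W /\ W \is a realmx.

Definition eigenmatrix_cliques (C : numClosedFieldType) (a : nat) : 'M[C]_4 :=
  let k : C := a%:R * (2 * a%:R - 1) in
  let m : C := 2 * a%:R - 1 in
  let rows : seq (seq C) :=
    [:: [:: 1;        k;            k;   m];
        [:: 1;  a%:R * 'i; - (a%:R * 'i); - 1];
        [:: 1; - (a%:R * 'i);  a%:R * 'i; - 1];
        [:: 1;    - a%:R;       - a%:R;   m]] in
  \matrix_(k < 4, j < 4) nth 0 (nth [::] rows k) j.

(* Main.v *)
Require Import Defs.
From HB Require Import structures.
From mathcomp Require Import all_boot all_order all_algebra.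
From mathcomp Require Import zify ring.
From mathcomp Require Import reals complex algC.

(* The matrix A1 - A2 is an eigenvector of A3 with integral eigenvalue r, and the
   difference of the R1 and R2 coefficients of W^2 = n I ties r to w1 + w2.  As w3
   is real, w3 = 1 or w3 = -1.

   If w3 = 1, then r = -1, so R3 is a union of cliques, and the remaining equations
   say that e = w1 + w2 is 0, which is the claim, or that a product formula holds
   which makes m^2 + 4m a perfect square for some m > 0; but this number lies
   strictly between (m+1)^2 and (m+2)^2.

   If w3 = -1, then (w1 - w2)^2 < 0 gives r > 0, and size estimates force r = 1 and
   valencies 5, 5, 5 on 16 points, with R3 triangle-free.  These intersection
   numbers satisfy the eigenvalue and Krein conditions and would make W Hadamard
   for w1 = i, so this case is excluded combinatorially: the out-neighbours of a point
   form a directed 5-cycle, and chasing it along an arc produces two points with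
   three common R3-neighbours instead of two. *)

Set Implicit Arguments.
Unset Strict Implicit.
Unset Printing Implicit Defensive.

Import Order.TTheory GRing.Theory Num.Theory.
Local Open Scope ring_scope.

(** * Orientations of the complement of the Clebsch graph *)

Section CardLists.
Variables (T : finType).
Implicit Types (A : {set T}) (s : seq T).

Lemma card_ge_uniq A s : uniq s -> all (mem A) s -> (size s <= #|A|)%N.
Proof.
move=> s_uniq /allP sA; rewrite -(card_uniqP s_uniq).
by apply/subset_leq_card/subsetP => z /sA.
Qed.

Lemma mem_uniq_card A s z :
  uniq s -> all (mem A) s -> #|A| = size s -> z \in A -> z \in s.
Proof.
move=> s_uniq sA cA zA; case: (boolP (z \in s)) => // zs.
have := @card_ge_uniq A (z :: s); rewrite /= zs s_uniq sA cA andbT ltnn.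
by rewrite zA => /(_ isT isT).
Qed.

Lemma exists_notin A s : (size s < #|A|)%N -> exists2 z, z \in A & z \notin s.
Proof.
move=> ltsA; case: (pickP [pred z in A | z \notin s]) => [z /andP[] | h].
  by exists z.
suff: (#|A| <= size s)%N by rewrite leqNgt ltsA.
apply: leq_trans (card_size s); apply/subset_leq_card/subsetP => z zA.
by have := h z; rewrite /= zA /= => /negbFE.
Qed.

End CardLists.

(** * [a] models R1 and [e] models R3, with the 16-point parameters left by w3 = -1 *)

Section Clebsch.
Variables (X : finType) (a e : rel X).
Hypothesis a_irr : irreflexive a.
Hypothesis e_sym : symmetric e.
Hypothesis a_asym : forall x y, a x y -> a y x = false.
Hypothesis a_e : forall x y, a x y -> e x y = false.
Hypothesis cover : forall x y, [|| x == y, a x y, a y x | e x y].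
Hypothesis out5 : forall x, #|[set z | a x z]| = 5%N.
Hypothesis nbr5 : forall x, #|[set z | e x z]| = 5%N.
(** In the names of these counts the suffix places z relative to x, then to y: [o] for an
    out-neighbour, [i] for an in-neighbour, [e] for an [e]-neighbour. *)
Hypothesis a_oo : forall x y, a x y -> #|[set z | a x z && a y z]| = 1%N.
Hypothesis a_oi : forall x y, a x y -> #|[set z | a x z && a z y]| = 1%N.
Hypothesis a_ee : forall x y, a x y -> #|[set z | e x z && e z y]| = 2%N.
Hypothesis a_eo : forall x y, a x y -> #|[set z | e x z && a y z]| = 1%N.
Hypothesis e_oe : forall x y, e x y -> #|[set z | a x z && e z y]| = 2%N.
Hypothesis e_ee : forall x y z, e x y -> e y z -> e x z = false.

Lemma card1_eq (A : {set X}) x y : #|A| = 1%N -> x \in A -> y \in A -> x = y.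
Proof. by move/eqP/cards1P => [z ->]; rewrite !inE => /eqP-> /eqP->. Qed.

Lemma a_neq x y : a x y -> x != y.
Proof. by apply: contraTneq => ->; rewrite a_irr. Qed.

Lemma a_e' x y : a x y -> e y x = false.
Proof. by rewrite e_sym; apply: a_e. Qed.

Lemma e_a x y : e x y -> a x y = false.
Proof. by move=> h; apply/negP => /a_e; rewrite h. Qed.

Lemma a_oo_eq x y z z' : a x y -> a x z -> a y z -> a x z' -> a y z' -> z = z'.
Proof. by move=> /a_oo h *; apply: card1_eq h _ _; rewrite inE; apply/andP. Qed.

Lemma a_oi_eq x y z z' : a x y -> a x z -> a z y -> a x z' -> a z' y -> z = z'.
Proof. by move=> /a_oi h *; apply: card1_eq h _ _; rewrite inE; apply/andP. Qed.

Lemma a_eo_eq x y z z' : a x y -> e x z -> a y z -> e x z' -> a y z' -> z = z'.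
Proof. by move=> /a_eo h *; apply: card1_eq h _ _; rewrite inE; apply/andP. Qed.

Definition wheel x q0 q1 q2 q3 q4 :=
  [/\ [/\ a x q0, a x q1, a x q2, a x q3 & a x q4] &
      [/\ a q0 q1, a q1 q2, a q2 q3, a q3 q4 & a q4 q0]].

Lemma wheel_rot x q0 q1 q2 q3 q4 :
  wheel x q0 q1 q2 q3 q4 -> wheel x q1 q2 q3 q4 q0.
Proof. by case=> -[? ? ? ? ?] [? ? ? ? ?]. Qed.

Lemma a2_neq x y z : a x y -> a y z -> x != z.
Proof. by move=> xy; apply: contraTneq => <-; rewrite (a_asym xy). Qed.

(** Two positions on a 5-cycle are one or two steps apart; irreflexivity of [a] separates the first
    kind, asymmetry the second. *)
Lemma wheel_uniq x q0 q1 q2 q3 q4 :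
  wheel x q0 q1 q2 q3 q4 -> uniq [:: q0; q1; q2; q3; q4].
Proof.
case=> _ [a01 a12 a23 a34 a40]; rewrite /= !inE !negb_or.
rewrite (a_neq a01) (a2_neq a01 a12) (a_neq a12) (a2_neq a12 a23) (a_neq a23).
rewrite (a2_neq a23 a34) (a_neq a34) (eq_sym q0 q3) (a2_neq a34 a40).
by rewrite (eq_sym q0 q4) (a_neq a40) (eq_sym q1 q4) (a2_neq a40 a01).
Qed.

Lemma wheel_mem x q0 q1 q2 q3 q4 z : wheel x q0 q1 q2 q3 q4 -> a x z ->
  z \in [:: q0; q1; q2; q3; q4].
Proof.
move=> hw xz; apply: (@mem_uniq_card _ [set z | a x z]).
- exact: wheel_uniq hw.
- by case: hw => -[h0 h1 h2 h3 h4] _; rewrite /= !inE h0 h1 h2 h3 h4.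
- by rewrite out5.
- by rewrite inE.
Qed.

(** By [a_oo] a rim point has only one out-neighbour on the rim, so an arc between q0 and q2 in
    either direction would identify two rim points. *)
Lemma wheel_e x q0 q1 q2 q3 q4 : wheel x q0 q1 q2 q3 q4 -> e q0 q2.
Proof.
move=> hw; have := wheel_uniq hw.
case: hw => -[h0 h1 h2 h3 h4] [a01 a12 a23 a34 a40] hu.
case/or4P: (cover q0 q2) => //.
- by move/eqP=> q02; move: hu; rewrite q02 /= !inE eqxx !orbT.
- move=> a02; have q12 := a_oo_eq h0 h1 a01 h2 a02.
  by move: hu; rewrite q12 /= !inE eqxx /= !andbF.
- move=> a20; have q03 := a_oo_eq h2 h0 a20 h3 a23.
  by move: hu; rewrite q03 /= !inE eqxx !orbT.
Qed.

Lemma arc_next x y : a x y -> exists2 z, a x z & a y z.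
Proof.
move=> /a_oo/eqP/cards1P[z hz]; have: z \in [set z] by rewrite inE.
by rewrite -hz inE => /andP[]; exists z.
Qed.

Lemma out_mem x s z : uniq s -> all (a x) s -> size s = 5%N -> a x z -> z \in s.
Proof.
move=> s_uniq sa sz xz; apply: (@mem_uniq_card _ [set z | a x z]); rewrite ?inE //.
  by apply: sub_all sa => t; rewrite /= inE.
by rewrite out5.
Qed.

Lemma out_notin x s : (size s < 5)%N -> exists2 z, a x z & z \notin s.
Proof.
by rewrite -(out5 x) => /exists_notin[z]; rewrite inE; exists z.
Qed.

(* Following arcs inside the out-neighbourhood of x permutes its 5 points without
   fixed points or 2-cycles, hence cyclically. *)
Lemma wheel_exists x q0 q1 : a x q0 -> a x q1 -> a q0 q1 ->
  exists q2 q3 q4, wheel x q0 q1 q2 q3 q4.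
Proof.
move=> x0 x1 a01.
have [q2 x2 a12] := arc_next x1; have [q3 x3 a23] := arc_next x2.
have [q4 x4 a34] := arc_next x3.
have n01 := a_neq a01; have n12 := a_neq a12; have n23 := a_neq a23.
have n34 := a_neq a34; have n02 := a2_neq a01 a12; have n13 := a2_neq a12 a23.
have n24 := a2_neq a23 a34.
(* Here q3 = q0 would close a 3-cycle. By [a_oi] an arc starting off this cycle cannot enter it, so
   b, c, d lie among the two other out-neighbours of x; then d = b, against asymmetry. *)
have n03 : q0 != q3.
  apply/eqP => q03; rewrite -q03 in a23.
  have [b xb] := @out_notin x [:: q0; q1; q2] isT.
  rewrite !inE !negb_or => /and3P[b0 b1 b2].
  have [c xc bc] := arc_next xb; have [d xd cd] := arc_next xc.
  have avoid u v : a x u -> a x v -> a u v -> u != q0 -> u != q1 -> u != q2 ->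
      [&& v != q0, v != q1 & v != q2].
    move=> xu xv auv u0 u1 u2; apply/and3P; split.
    - by apply: contraNneq u2 => v0; rewrite v0 in auv;
       rewrite (a_oi_eq x0 xu auv x2 a23).
    - by apply: contraNneq u0 => v1; rewrite v1 in auv;
       rewrite (a_oi_eq x1 xu auv x0 a01).
    - by apply: contraNneq u1 => v2; rewrite v2 in auv;
       rewrite (a_oi_eq x2 xu auv x1 a12).
  have /and3P[c0 c1 c2] := avoid _ _ xb xc bc b0 b1 b2.
  have /and3P[d0 d1 d2] := avoid _ _ xc xd cd c0 c1 c2.
  have := @out_mem x [:: q0; q1; q2; b; c] d.
  rewrite /= !inE !negb_or n01 n02 n12 (eq_sym q0) b0 (eq_sym q0) c0 (eq_sym q1) b1.
  rewrite (eq_sym q1) c1 (eq_sym q2) b2 (eq_sym q2) c2 (a_neq bc) x0 x1 x2 xb xc.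
  rewrite (negPf d0) (negPf d1) (negPf d2) (eq_sym d c) (negPf (a_neq cd)) /= orbF.
  by rewrite eq_sym (negPf (a2_neq bc cd)) => /(_ isT isT erefl xd).
have n14 : q1 != q4.
  by apply: contraNneq n03 => q14; rewrite -q14 in a34;
     rewrite (a_oi_eq x1 x3 a34 x0 a01).
(* A 4-cycle would leave a single b, whose outgoing arc would be a loop or give a cycle point a
   second in-neighbour. *)
have n04 : q0 != q4.
  apply/eqP => q04; rewrite -q04 in a34.
  have [b xb] := @out_notin x [:: q0; q1; q2; q3] isT.
  rewrite !inE !negb_or => /and4P[b0 b1 b2 b3].
  have [c xc bc] := arc_next xb.
  have := @out_mem x [:: q0; q1; q2; q3; b] c.
  rewrite /= !inE !negb_or n01 n02 n12 n03 n13 n23 (eq_sym q0) b0 (eq_sym q1) b1.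
  rewrite (eq_sym q2) b2 (eq_sym q3) b3 x0 x1 x2 x3 xb => /(_ isT isT erefl xc).
  case/or4P=> [/eqP c0|/eqP c1|/eqP c2|/orP[/eqP c3|/eqP cb]].
  - by move: b3; rewrite c0 in bc; rewrite (a_oi_eq x0 xb bc x3 a34) eqxx.
  - by move: b0; rewrite c1 in bc; rewrite (a_oi_eq x1 xb bc x0 a01) eqxx.
  - by move: b1; rewrite c2 in bc; rewrite (a_oi_eq x2 xb bc x1 a12) eqxx.
  - by move: b2; rewrite c3 in bc; rewrite (a_oi_eq x3 xb bc x2 a23) eqxx.
  - by move: (a_neq bc); rewrite cb eqxx.
exists q2, q3, q4; split; split=> //.
have [r xr ar] := arc_next x4.
have := @out_mem x [:: q0; q1; q2; q3; q4] r.
rewrite /= !inE !negb_or n01 n02 n12 n03 n13 n23 n34 n24 n14 n04 x0 x1 x2 x3 x4.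
move=> /(_ isT isT erefl xr).
case/or4P=> [/eqP r0|/eqP r1|/eqP r2|/orP[/eqP r3|/eqP r4]].
- by rewrite -r0.
- by move: n04; rewrite r1 in ar; rewrite (a_oi_eq x1 x4 ar x0 a01) eqxx.
- by move: n14; rewrite r2 in ar; rewrite (a_oi_eq x2 x4 ar x1 a12) eqxx.
- by move: n24; rewrite r3 in ar; rewrite (a_oi_eq x3 x4 ar x2 a23) eqxx.
- by move: (a_neq ar); rewrite r4 eqxx.
Qed.

(** Each common [e]-neighbour of x and q0 has, by [e_oe], a second [e]-neighbour on the rim, which
    can only be q1 or q4 as [e] has no triangles. There are two such points, and if both chose q4,
    then q4 and q0 would share three [e]-neighbours, the third being q2. *)
Lemma wheel_rim x q0 q1 q2 q3 q4 : wheel x q0 q1 q2 q3 q4 ->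
  exists p, [/\ e x p, e p q0 & e p q1].
Proof.
move=> hw; have hu := wheel_uniq hw.
have [[x0 x1 x2 x3 x4] [a01 a12 a23 a34 a40]] := hw.
have rim p : e x p -> e p q0 -> e p q1 \/ e p q4.
  move=> xp p0.
  have [z] : exists2 z, z \in [set z | a x z && e z p] & z \notin [:: q0].
    by apply: exists_notin; rewrite e_oe.
  rewrite !inE => /andP[xz zp] z0; have := wheel_mem hw xz.
  rewrite !inE (negPf z0) /= => /or4P[] /eqP ez; rewrite ez e_sym in zp.
  - by left.
  - by have := e_ee p0 (wheel_e hw); rewrite zp.
  - have hw3 := wheel_rot (wheel_rot (wheel_rot hw)).
    by have := e_ee zp (wheel_e hw3); rewrite p0.
  - by right.
have /eqP := a_ee x0; case/cards2P=> w [w' [ww' h]].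
have: w \in [set w; w'] by rewrite !inE eqxx.
rewrite -h inE => /andP[xw w0]; case: (rim _ xw w0) => [w1|w4]; first by exists w.
have: w' \in [set w; w'] by rewrite !inE eqxx orbT.
rewrite -h inE => /andP[xw' w'0]; case: (rim _ xw' w'0) => [w'1|w'4]; first by exists w'.
have := @card_ge_uniq _ [set z | e q4 z && e z q0] [:: w; w'; q2].
rewrite a_ee //= !inE !negb_or ww' w0 w'0 !(e_sym q4) w4 w'4 (e_sym q2 q0) (wheel_e hw).
have hw2 := wheel_rot (wheel_rot hw).
rewrite (wheel_e hw2).
have nx q : e x q -> q != q2 by apply: contraTneq => ->; rewrite (a_e x2).
by rewrite !nx // => /(_ isT isT).
Qed.

Lemma e_ee_adj p q r : e p q -> e p r -> e q r = false.
Proof. by rewrite e_sym; apply: e_ee. Qed.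

(** Apply [wheel_rim] to each rim arc. A coincidence of two of the points would give an
    [e]-triangle, so the five exhaust the [e]-neighbours of x. *)
Lemma wheel_rims x q0 q1 q2 q3 q4 : wheel x q0 q1 q2 q3 q4 ->
  exists p0 p1 p2 p3 p4,
    [/\ [/\ e x p0, e x p1, e x p2, e x p3 & e x p4],
        [/\ e p0 q0, e p1 q1, e p2 q2, e p3 q3 & e p4 q4],
        [/\ e p0 q1, e p1 q2, e p2 q3, e p3 q4 & e p4 q0],
        uniq [:: p0; p1; p2; p3; p4] &
        forall w, e x w -> w \in [:: p0; p1; p2; p3; p4]].
Proof.
move=> w0; have w1 := wheel_rot w0; have w2 := wheel_rot w1.
have w3 := wheel_rot w2; have w4 := wheel_rot w3.
have [p0 [x0 p00 p01]] := wheel_rim w0; have [p1 [x1 p11 p12]] := wheel_rim w1.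
have [p2 [x2 p22 p23]] := wheel_rim w2; have [p3 [x3 p33 p34]] := wheel_rim w3.
have [p4 [x4 p44 p40]] := wheel_rim w4.
have neq p p' q q' : e p q -> e p' q' -> e q q' -> p != p'.
  by move=> pq p'q' qq'; apply: contraTneq pq => ->; rewrite e_sym; apply/negP => qp;
     have := e_ee qp p'q'; rewrite qq'.
exists p0, p1, p2, p3, p4.
have hu : uniq [:: p0; p1; p2; p3; p4].
  rewrite /= !inE !negb_or.
  rewrite (neq _ _ _ _ p00 p12 (wheel_e w0)) (neq _ _ _ _ p00 p22 (wheel_e w0)).
  rewrite (neq _ _ _ _ p01 p33 (wheel_e w1)).
  rewrite [p0 == p4]eq_sym (neq _ _ _ _ p44 p01 (wheel_e w4)).
  rewrite (neq _ _ _ _ p11 p23 (wheel_e w1)) (neq _ _ _ _ p11 p33 (wheel_e w1)).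
  rewrite (neq _ _ _ _ p12 p44 (wheel_e w2)).
  rewrite (neq _ _ _ _ p22 p34 (wheel_e w2)) (neq _ _ _ _ p22 p44 (wheel_e w2)).
  by rewrite (neq _ _ _ _ p33 p40 (wheel_e w3)).
split=> // w xw; apply: (@mem_uniq_card _ [set z | e x z]); rewrite ?nbr5 ?inE //.
by rewrite /= !inE x0 x1 x2 x3 x4.
Qed.

(** Here p1 and p2 lie over the arcs q1 q2 and q2 q3, and p1 is the one [e]-neighbour of x that q0
    points to. The points u and v are recorded for comparison with the wheel rotated by one step. *)
Lemma wheel_spoke x q0 q1 q2 q3 q4 : wheel x q0 q1 q2 q3 q4 ->
  exists p1 p2 u,
  [/\ [/\ e x p1, a q0 p1, e p1 q1 & e p1 q2],
      [/\ e x p2, e p2 q2 & e p2 q3],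
      a q0 u, e u q3 & [/\ u != q1, (forall p, e x p -> p != u) & exists v,
      [/\ a q0 v, e v q2 & v \notin [:: q4; q0; p1; p2]]]].
Proof.
move=> w0; have w1 := wheel_rot w0; have w2 := wheel_rot w1.
have w3 := wheel_rot w2; have w4 := wheel_rot w3.
have e02 := wheel_e w0; have e13 := wheel_e w1; have e24 := wheel_e w2.
have e30 := wheel_e w3; have e41 := wheel_e w4.
have [[x0 x1 x2 x3 x4] [a01 a12 a23 a34 a40]] := w0.
have [p0 [p1 [p2 [p3 [p4 [[xp0 xp1 xp2 xp3 xp4] [p00 p11 p22 p33 p44]
  [p01 p12 p23 p34 p40] pu pm]]]]]] := wheel_rims w0.
have neq_xx p q : e x p -> a x q -> p != q.
  by move=> xp; apply: contraTneq => <-; rewrite (e_a xp).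
(* The points x, q4, q0 and the two points given by [e_oe] already make up the five [e]-neighbours
   of p4. *)
have out_p4 u : e p4 u -> u != x -> u != q4 -> u != q0 -> a q0 u.
  move=> p4u ux u4 u0; apply/negPn/negP => a0u.
  have /eqP := e_oe (etrans (e_sym _ _) p40); case/cards2P=> z [z' [zz' h]].
  have: z \in [set z; z'] by rewrite !inE eqxx.
  rewrite -h inE => /andP[a0z zp4].
  have: z' \in [set z; z'] by rewrite !inE eqxx orbT.
  rewrite -h inE => /andP[a0z' z'p4].
  have := @card_ge_uniq _ [set z | e p4 z] [:: u; x; q4; q0; z; z'].
  rewrite nbr5 /= !inE !negb_or ux u4 u0 zz' p4u p44 p40 !(e_sym p4) xp4 zp4 z'p4.
  have nu y : a q0 y -> u != y by apply: contraTneq => <-.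
  have nx y : a q0 y -> x != y by apply: contraTneq => <-; rewrite (a_asym x0).
  have n4 y : a q0 y -> q4 != y by apply: contraTneq => <-; rewrite (a_asym a40).
  rewrite !(nu z, nu z', nx z, nx z', n4 z, n4 z') //.
  rewrite !(a_neq x4, a_neq x0, a_neq a40, a_neq a0z, a_neq a0z').
  by move=> /(_ isT isT).
have np43 : e p4 q3 = false by apply: e_ee p40 _; rewrite e_sym.
(* As q3 and p4 are distinct and not [e]-adjacent, they have two common [e]-neighbours whichever way
   their arc goes; one is q0, and u is the other. *)
have [u] : exists2 u, u \in [set z | e q3 z && e z p4] & u \notin [:: q0].
  apply: exists_notin; suff -> : #|[set z | e q3 z && e z p4]| = 2%N by [].
  case/or4P: (cover q3 p4) => [/eqP h|h|h|].
  - by have := neq_xx _ _ xp4 x3; rewrite h eqxx.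
  - exact: a_ee.
  - rewrite -(a_ee h); apply: eq_card => z.
    by rewrite !inE andbC e_sym [e z q3]e_sym.
  - by rewrite e_sym np43.
rewrite !inE => /andP[q3u up4] u0.
have a0u : a q0 u.
  apply: out_p4 => //; first by rewrite e_sym.
  - by apply: contraTneq q3u => ->; rewrite (a_e' x3).
  - by apply: contraTneq q3u => ->; rewrite (a_e a34).
have n41 : e p4 q1 = false by apply: e_ee p44 e41.
have uq1 : u != q1 by apply: contraTneq up4 => ->; rewrite e_sym n41.
have neq_u p : e x p -> p != u.
  by move=> xp; apply: contraTneq up4 => <-; rewrite (e_ee_adj xp xp4).
(* By [e_oe] exactly two out-neighbours of q0 are [e]-adjacent to q3, and q1 and u are such. *)
have q0q3 p : e x p -> e p q3 -> a q0 p = false.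
  move=> xp pq3; apply/negP => a0p.
  have := @mem_uniq_card _ [set v | a q0 v && e v q3] [:: q1; u] p.
  rewrite e_oe ?(e_sym q0) //= !inE (eq_sym q1) uq1 a01 e13 a0u (e_sym u) q3u.
  by rewrite a0p pq3 (negPf (neq_xx _ _ xp x1)) (negPf (neq_u _ xp)) =>
    /(_ isT isT erefl isT).
(* The point supplied by [a_eo] is found by elimination: p0 and p4 are [e]-adjacent to q0, while p2
   and p3 are excluded by [q0q3]. *)
have a0p1 : a q0 p1.
  have /eqP/cards1P[w hw] := a_eo x0.
  have: w \in [set w] by rewrite inE.
  rewrite -hw inE => /andP[xw a0w].
  have := pm _ xw; rewrite !inE => /or4P[/eqP h|/eqP h|/eqP h|/orP[/eqP h|/eqP h]];
    rewrite h in a0w => //.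
  - by rewrite (a_e' a0w) in p00.
  - by rewrite (q0q3 _ xp2 p23) in a0w.
  - by rewrite (q0q3 _ xp3 p33) in a0w.
  - by rewrite (a_e' a0w) in p40.
exists p1, p2, u; split; [by split|by split|by []|by rewrite e_sym|].
split=> //.
have [v] : exists2 v, v \in [set v | a q0 v && e v q2] & v \notin [:: p1].
  by apply: exists_notin; rewrite e_oe.
rewrite !inE => /andP[a0v vq2] vp1; exists v; split=> //.
rewrite !inE !negb_or vp1 eq_sym (a2_neq a40 a0v) eq_sym (a_neq a0v) /=.
by apply: contraTneq a0v => ->; rewrite q0q3.
Qed.

(* The spokes at q0 and q1 give the same u, because q3 has only 5 e-neighbours:
   q0, q1, p2, p3 and u. *)
Lemma wheel_out x q0 q1 q2 q3 q4 : wheel x q0 q1 q2 q3 q4 ->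
  exists u, [/\ a q0 u, a q1 u & e u q2 = false].
Proof.
move=> w0; have w1 := wheel_rot w0; have w2 := wheel_rot w1.
have w3 := wheel_rot w2; have w4 := wheel_rot w3.
have e02 := wheel_e w0; have e13 := wheel_e w1; have e30 := wheel_e w3.
have [[x0 x1 x2 x3 x4] [a01 a12 a23 a34 a40]] := w0.
have [p1 [p2 [u [[xp1 a0p1 p11 p12] [xp2 p22 p23] a0u uq3 [uq1 xu _]]]]] :=
  wheel_spoke w0.
have [p2' [p3 [u' [[xp2' a1p2' p22' p23'] [xp3 p33 p34] a1u' u'q4 [_ _ [v]]]]]] :=
  wheel_spoke w1.
move=> [a1v vq3]; rewrite !inE !negb_or => /and4P[v0 v1 vp2' vp3].
have cap23 z : e q2 z -> e z q3 -> z != q0 -> z != p2 -> False.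
  move=> q2z zq3 z0 zp2.
  have := @card_ge_uniq _ [set z | e q2 z && e z q3] [:: z; q0; p2].
  rewrite a_ee //= !inE !negb_or z0 zp2 q2z zq3 (e_sym q2) e02 (e_sym q0) e30.
  rewrite (e_sym q2) p22 p23.
  have -> : q0 != p2 by apply: contraTneq xp2 => <-; rewrite (a_e x0).
  by move=> /(_ isT isT).
have p2E : p2' = p2.
  apply/eqP/negPn/negP => h; apply: (@cap23 p2') => //; first by rewrite e_sym.
  by apply: contraTneq xp2' => ->; rewrite (a_e x0).
subst p2'.
have uv : u = v.
  have := @mem_uniq_card _ [set z | e q3 z] [:: q0; q1; p2; p3; v] u.
  have nq p q : e x p -> a x q -> q != p.
    by move=> xp; apply: contraTneq => ->; rewrite (e_a xp).
  have p23n : p2 != p3.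
    apply: contraTneq p22 => ->; rewrite e_sym; apply/negP => h.
    by have := e_ee h p34; rewrite (wheel_e w2).
  rewrite nbr5 /= !inE !negb_or ![_ == v]eq_sym v0 v1 vp2' vp3 (a_neq a01) p23n !nq //.
  rewrite !(e_sym q3) e13 p23 p33 vq3 uq3 e_sym e30 ![u == _]eq_sym.
  rewrite (negPf (a_neq a0u)) (eq_sym q1) (negPf uq1) (negPf (xu _ xp2))
     (negPf (xu _ xp3)).
  by move=> /(_ isT isT erefl isT)/eqP.
exists u; split=> //; first by rewrite uv.
apply/negP => uq2; apply: (@cap23 u) => //; first by rewrite e_sym.
- by rewrite eq_sym a_neq.
- by rewrite eq_sym xu.
Qed.

(** In the wheel with hub q0 that starts with q1 and u, the spoke p is an [e]-neighbour of q0 and an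
    out-neighbour of q1. So is q2, hence p = q2 by [a_eo]; but p is [e]-adjacent to u and q2 is
    not. *)
Lemma no_orientation : ~ exists x y, a x y.
Proof.
case=> x [q0 x0]; have [q1 x1 a01] := arc_next x0.
have [q2 [q3 [q4 w0]]] := wheel_exists x0 x1 a01.
have [u [a0u a1u uq2]] := wheel_out w0.
have [r2 [r3 [r4 w']]] := wheel_exists a01 a0u a1u.
have [p [_ [_ [[pq0 a1p pu _] _ _ _ _]]]] := wheel_spoke w'.
rewrite (a_eo_eq a01 pq0 a1p (wheel_e w0)) in pu; first by rewrite e_sym pu in uq2.
by case: w0 => _ [].
Qed.

End Clebsch.

(** * Bose-Mesner algebra and intersection numbers *)

Section BoseMesnerTheory.
Variables (C : numClosedFieldType) (X : finType) (d : nat).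
Variable S : assoc_scheme X d.
Local Notation A := (adj C S).
Local Notation p := (inter_num S).

Lemma scheme_eq_rel k l x y : S k x y -> S l x y = (l == k).
Proof.
move=> kxy; apply/idP/eqP => [lxy|-> //]; exact: scheme_disjoint lxy kxy.
Qed.

Lemma adj_comb_entry (c : 'I_d.+1 -> C) k x y : S k x y ->
  (\sum_l c l *: A l) (enum_rank x) (enum_rank y) = c k.
Proof.
move=> kxy; rewrite summxE (bigD1 k) //= !mxE !enum_rankK kxy mulr1.
rewrite big1 ?addr0 // => l lk.
by rewrite !mxE !enum_rankK (scheme_eq_rel _ kxy) (negPf lk) mulr0.
Qed.

Lemma adj_free (c c' : 'I_d.+1 -> C) :
  \sum_l c l *: A l = \sum_l c' l *: A l -> c =1 c'.
Proof.
move=> e k; have [x [y kxy]] := scheme_nonempty S k.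
by rewrite -(adj_comb_entry c kxy) e (adj_comb_entry c' kxy).
Qed.

Lemma adj_comb_eq (M : 'M[C]_#|X|) (c : 'I_d.+1 -> C) :
  (forall k x y, S k x y -> M (enum_rank x) (enum_rank y) = c k) ->
  M = \sum_k c k *: A k.
Proof.
move=> h; apply/matrixP => i j; rewrite -(enum_valK i) -(enum_valK j).
have [k kxy] := scheme_cover S (enum_val i) (enum_val j).
by rewrite (h k) // (adj_comb_entry c kxy).
Qed.

Lemma adj0 : A ord0 = 1%:M.
Proof.
by apply/matrixP => i j; rewrite !mxE scheme_diag (inj_eq enum_val_inj).
Qed.

Lemma sum_adj : \sum_k A k = const_mx 1.
Proof.
rewrite [RHS](@adj_comb_eq _ (fun=> 1)) => [|k x y _]; last by rewrite mxE.
by apply: eq_bigr => k _; rewrite scale1r.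
Qed.

Lemma adj_mul i j : A i *m A j = \sum_k (p i j k)%:R *: A k.
Proof.
apply: adj_comb_eq => k x y kxy; rewrite mxE -(scheme_inter i j kxy).
rewrite (reindex_onto enum_rank enum_val) /=; last by move=> ? _; rewrite enum_valK.
rewrite -[X in _ = X%:R]sum1_card natr_sum big_mkcond [RHS]big_mkcond.
apply: eq_bigr => z _; rewrite enum_rankK eqxx !mxE !enum_rankK inE.
by case: (S i x z); case: (S j z y); rewrite ?mulr0 ?mul0r ?mulr1.
Qed.

Lemma adj_comb_mul (c c' : 'I_d.+1 -> C) :
  (\sum_i c i *: A i) *m (\sum_j c' j *: A j) =
  \sum_k (\sum_i \sum_j c i * c' j * (p i j k)%:R) *: A k.
Proof.
rewrite mulmx_suml; under eq_bigr => i _.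
  rewrite mulmx_sumr; under eq_bigr => j _.
    rewrite -scalemxAl -scalemxAr scalerA adj_mul scaler_sumr.
    under eq_bigr => k _ do rewrite scalerA.
    over.
  rewrite exchange_big /=; under eq_bigr => k _ do rewrite -scaler_suml.
  over.
by rewrite exchange_big /=; under eq_bigr => k _ do rewrite -scaler_suml.
Qed.

End BoseMesnerTheory.

(** * Identities between intersection numbers of an arbitrary scheme *)

Section IntersectionNumbers.
Variables (X : finType) (d : nat) (S : assoc_scheme X d).
Local Notation p := (inter_num S).

Lemma inter_num0l j k : p ord0 j k = (j == k).
Proof.
have [x [y kxy]] := scheme_nonempty S k; rewrite -(scheme_inter _ _ kxy).
rewrite (_ : [set z | _] = if j == k then [set x] else set0).
  by case: eqP => _; rewrite ?cards1 ?cards0.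
apply/setP => z; rewrite inE scheme_diag eq_sym; case: (z =P x) => [->|zx] /=.
  by rewrite (scheme_eq_rel _ kxy); case: eqP; rewrite !inE ?eqxx.
by case: ifP => _; rewrite !inE //; apply/esym/eqP.
Qed.

Lemma inter_num0r i k : p i ord0 k = (i == k).
Proof.
have [x [y kxy]] := scheme_nonempty S k; rewrite -(scheme_inter _ _ kxy).
rewrite (_ : [set z | _] = if i == k then [set y] else set0).
  by case: eqP => _; rewrite ?cards1 ?cards0.
apply/setP => z; rewrite inE scheme_diag andbC; case: (z =P y) => [->|zx] /=.
  by rewrite (scheme_eq_rel _ kxy); case: eqP; rewrite !inE ?eqxx.
by case: ifP => _; rewrite !inE //; apply/esym/eqP.
Qed.

Lemma inter_num_transpose i j k i' j' k' :
  (forall x y, S i' x y = S i y x) -> (forall x y, S j' x y = S j y x) ->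
  (forall x y, S k' x y = S k y x) -> p j' i' k' = p i j k.
Proof.
move=> ti tj tk; have [x [y kxy]] := scheme_nonempty S k.
rewrite -(scheme_inter _ _ kxy) -(@scheme_inter _ _ S j' i' k' y x) ?tk //.
by apply: eq_card => z; rewrite !inE ti tj andbC.
Qed.

Lemma inter_num_diagl i j i' : (forall x y, S i' x y = S i y x) ->
  j != i' -> p i j ord0 = 0%N.
Proof.
move=> ti ji; have [x [y xy]] := scheme_nonempty S ord0.
rewrite -(scheme_inter _ _ xy); apply/eqP; rewrite cards_eq0.
move: xy; rewrite scheme_diag => /eqP <-.
apply/eqP/setP => z; rewrite !inE; apply/negP => /andP[ixz jzx].
by move: ji; rewrite (@scheme_disjoint _ _ S j i' z x) ?eqxx // ti.
Qed.

Lemma inter_num_diagr i j j' : (forall x y, S j' x y = S j y x) ->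
  i != j' -> p i j ord0 = 0%N.
Proof.
move=> tj ij; have [x [y xy]] := scheme_nonempty S ord0.
rewrite -(scheme_inter _ _ xy); apply/eqP; rewrite cards_eq0.
move: xy; rewrite scheme_diag => /eqP <-.
apply/eqP/setP => z; rewrite !inE; apply/negP => /andP[ixz jzx].
by move: ij; rewrite (@scheme_disjoint _ _ S i j' x z) ?eqxx // tj.
Qed.

Lemma valency_gt0 i i' : (forall x y, S i' x y = S i y x) ->
  (0 < p i i' ord0)%N.
Proof.
move=> ti; have [x [z ixz]] := scheme_nonempty S i.
have xx : S ord0 x x by rewrite scheme_diag.
rewrite -(scheme_inter _ _ xx); apply/card_gt0P; exists z.
by rewrite inE ti ixz.
Qed.

Lemma card_sphere i k x y : S k x y ->
  #|[set z | S i x z]| = (\sum_j p i j k)%N.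
Proof.
move=> kxy; under eq_bigr => l _ do
  rewrite -(scheme_inter i l kxy) -sum1_card big_mkcond /=.
rewrite exchange_big -sum1_card big_mkcond /=; apply: eq_bigr => z _.
have [l lzy] := scheme_cover S z y; rewrite (bigD1 l) //= big1 => [|m ml].
  by rewrite !inE lzy andbT addn0.
by rewrite !inE (scheme_eq_rel _ lzy) (negPf ml) andbF.
Qed.

(** Both sides are the valency of R_i, with the neighbours sorted by their relation to different
    reference points. *)
Lemma sum_inter_num i k : (\sum_j p i j k)%N = (\sum_j p i j ord0)%N.
Proof.
have [x [y kxy]] := scheme_nonempty S k; rewrite -(card_sphere i kxy).
by rewrite (@card_sphere i ord0 x x) // scheme_diag.
Qed.

(** Associativity of the product of adjacency matrices, read off coefficientwise; [algC] merely
    provides a field of characteristic 0 for them. *)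
Lemma inter_num_assoc i j k m :
  (\sum_l p i j l * p l k m = \sum_l p j k l * p i l m)%N.
Proof.
apply/eqP; rewrite -(eqr_nat algC) !natr_sum; apply/eqP.
pose A := adj algC S.
suff /adj_free/(_ m) : \sum_t (\sum_l (p i j l * p l k t)%:R) *: A t =
  \sum_t (\sum_l (p j k l * p i l t)%:R) *: A t by [].
have eqL : \sum_t (\sum_l (p i j l * p l k t)%:R) *: A t = A i *m A j *m A k.
  rewrite adj_mul mulmx_suml; under [RHS]eq_bigr => l _.
    rewrite -scalemxAl adj_mul scaler_sumr.
    under eq_bigr => t _ do rewrite scalerA -natrM.
    over.
  by rewrite exchange_big; apply: eq_bigr => t _; rewrite scaler_suml.
rewrite eqL -mulmxA adj_mul mulmx_sumr; under eq_bigr => l _.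
  rewrite -scalemxAr adj_mul scaler_sumr.
  under eq_bigr => t _ do rewrite scalerA -natrM.
  over.
by rewrite exchange_big; apply: eq_bigr => t _; rewrite scaler_suml.
Qed.

Lemma card_scheme : #|X| = (\sum_k \sum_j p k j ord0)%N.
Proof.
have [x _] := scheme_nonempty S ord0.
have xx : S ord0 x x by rewrite scheme_diag.
under eq_bigr => k _ do rewrite -(card_sphere k xx) -sum1_card big_mkcond /=.
rewrite exchange_big -[LHS]sum1_card /=; apply: eq_bigr => z _.
have [l lxz] := scheme_cover S x z; rewrite (bigD1 l) //= big1 => [|m ml].
  by rewrite !inE lxz addn0.
by rewrite !inE (scheme_eq_rel _ lxz) (negPf ml).
Qed.

(** Both sides count the triangles of a given type at a fixed point. Formally this is associativity
    at the diagonal relation, where each sum keeps a single term. *)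
Lemma inter_num_triangle i j k i' k' :
  (forall x y, S i' x y = S i y x) -> (forall x y, S k' x y = S k y x) ->
  (p i j k * p k k' ord0 = p j k' i' * p i i' ord0)%N.
Proof.
move=> ti tk; have := inter_num_assoc i j k' ord0.
rewrite (bigD1 k) //= [X in _ = X](bigD1 i') //= !big1 ?addn0 // => l lk.
  by rewrite (inter_num_diagl ti lk) muln0.
rewrite (@inter_num_diagr l k' k) ?muln0 // => x y; exact/esym/tk.
Qed.

End IntersectionNumbers.

(** The terms carry the ring numerals of ['I_4] used in the theorem, in place of nested lifts. *)
Lemma big_ord4 (R : Type) (idx : R) (op : Monoid.law idx) (F : 'I_4 -> R) :
  \big[op/idx]_(k < 4) F k = op (F ord0) (op (F 1) (op (F 2) (F 3))).
Proof.
rewrite !big_ord_recl big_ord0 Monoid.mulm1.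
by congr (op (F _) (op (F _) (op (F _) (F _)))); apply: val_inj.
Qed.

Lemma ord4P (P : 'I_4 -> Prop) : P ord0 -> P 1 -> P 2 -> P 3 -> forall k, P k.
Proof.
move=> P0 P1 P2 P3 [[|[|[|[|//]]]] lt4].
- by rewrite (_ : Ordinal lt4 = ord0) //; apply: val_inj.
- by rewrite (_ : Ordinal lt4 = 1) //; apply: val_inj.
- by rewrite (_ : Ordinal lt4 = 2) //; apply: val_inj.
- by rewrite (_ : Ordinal lt4 = 3) //; apply: val_inj.
Qed.

(** * Class 3 with one transposed pair of relations *)

Section NonsymmetricClass3.
Variables (X : finType) (S : assoc_scheme X 3).
Hypothesis S_comm : commutative_scheme S.
Hypothesis R1_transpose : forall x y, S 2 x y = S 1 y x.
Hypothesis R3_sym : symmetric (S 3).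
Local Notation p := (inter_num S).

Lemma rel1_conv x y : S 2 x y = S 1 y x. Proof. exact: R1_transpose. Qed.
Lemma rel2_conv x y : S 1 x y = S 2 y x. Proof. by rewrite R1_transpose. Qed.
Lemma rel3_conv x y : S 3 x y = S 3 y x. Proof. exact: R3_sym. Qed.

Local Notation k1 := (p 1 2 ord0).
Local Notation p111 := (p 1 1 1).
Local Notation p131 := (p 1 3 1).
Local Notation p221 := (p 2 2 1).
Local Notation p231 := (p 2 3 1).
Local Notation p331 := (p 3 3 1).
Local Notation p113 := (p 1 1 3).
Local Notation p123 := (p 1 2 3).
Local Notation p133 := (p 1 3 3).
Local Notation p333 := (p 3 3 3).
Local Notation k3 := (p 3 3 ord0).

Lemma inter122 : p 1 2 2 = p 1 1 1.
Proof.
have /eqP := inter_num_triangle 1 rel1_conv rel1_conv.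
by rewrite eqn_pmul2r ?(valency_gt0 rel1_conv) // => /eqP.
Qed.

Lemma inter121 : p 1 2 1 = p 1 1 1.
Proof.
by rewrite -inter122; apply: inter_num_transpose rel1_conv rel2_conv rel2_conv.
Qed.

Lemma inter112 : p 1 1 2 = p 2 2 1.
Proof. exact: inter_num_transpose rel2_conv rel2_conv rel1_conv.
Qed.
Lemma inter222 : p 2 2 2 = p 1 1 1.
Proof. exact: inter_num_transpose rel1_conv rel1_conv rel1_conv.
Qed.
Lemma inter132 : p 1 3 2 = p 2 3 1.
Proof.
by rewrite (S_comm 2 3); apply: inter_num_transpose rel3_conv rel2_conv rel1_conv.
Qed.
Lemma inter232 : p 2 3 2 = p 1 3 1.
Proof.
by rewrite (S_comm 1 3); apply: inter_num_transpose rel3_conv rel1_conv rel1_conv.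
Qed.
Lemma inter332 : p 3 3 2 = p 3 3 1.
Proof. exact: inter_num_transpose rel3_conv rel3_conv rel1_conv.
Qed.
Lemma inter223 : p 2 2 3 = p 1 1 3.
Proof. exact: inter_num_transpose rel1_conv rel1_conv rel3_conv.
Qed.
Lemma inter233 : p 2 3 3 = p 1 3 3.
Proof.
by rewrite (S_comm 1 3); apply: inter_num_transpose rel3_conv rel1_conv rel3_conv.
Qed.

(** Transposition and commutativity reduce all [p i j k] with nonzero indices to nine numbers, those
    abbreviated above apart from the valencies [k1] and [k3]. *)
Definition interE := (inter121, inter122, inter112, inter222, inter132,
  inter232, inter332, inter223, inter233, S_comm 2 1, S_comm 3 1, S_comm 3 2).

Lemma inter_num_zero :
  [/\ p 1 1 ord0 = 0%N, p 2 2 ord0 = 0%N, p 1 3 ord0 = 0%N & p 2 3 ord0 = 0%N].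
Proof.
split; first exact: inter_num_diagl rel1_conv _.
- exact: inter_num_diagl rel2_conv _.
- exact: inter_num_diagl rel1_conv _.
- exact: inter_num_diagl rel2_conv _.
Qed.

Lemma row_sums :
  [/\ (1 + 2 * p111 + p131 = k1)%N,
      (p111 + p221 + p231 = k1)%N,
      (p131 + p231 + p331 = k3)%N,
      (p113 + p123 + p133 = k1)%N &
      (1 + 2 * p133 + p333 = k3)%N].
Proof.
have [p110 p220 p130 p230] := inter_num_zero.
have := sum_inter_num S 1 1; have := sum_inter_num S 2 1.
have := sum_inter_num S 3 1; have := sum_inter_num S 1 3.
have := sum_inter_num S 3 3; rewrite !big_ord4 !inter_num0r !interE /=.
rewrite p110 p220 p130 p230; clear => *; split; lia.
Qed.

Lemma triangle_counts :
  [/\ (k1 * p131 = k3 * p123)%N,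
      (k1 * p231 = k3 * p113)%N &
      (k1 * p331 = k3 * p133)%N].
Proof.
split.
- have := @inter_num_triangle _ _ S 3 1 1 _ _ rel3_conv rel1_conv.
  by rewrite (S_comm 3 1) mulnC [RHS]mulnC.
- have := @inter_num_triangle _ _ S 3 2 1 _ _ rel3_conv rel1_conv.
  by rewrite (S_comm 3 2) inter223 mulnC [RHS]mulnC.
- have := @inter_num_triangle _ _ S 3 3 1 _ _ rel3_conv rel1_conv.
  by rewrite (S_comm 3 2) inter233 mulnC [RHS]mulnC.
Qed.

(* Comparing (A3 A3) (A1 - A2) with A3 (A3 (A1 - A2)): the matrix A1 - A2 is an
   eigenvector of A3 for the eigenvalue p131 - p231. *)
Lemma eigenvalue_rel :
  (k3%:Z + (p331)%:Z * (p111%:Z - (p221)%:Z)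
     + (p333)%:Z * ((p131)%:Z - (p231)%:Z) =
   ((p131)%:Z - (p231)%:Z) ^+ 2)%R.
Proof.
have [p110 p220 p130 p230] := inter_num_zero.
have := inter_num_assoc S 3 3 1 1; have := inter_num_assoc S 3 3 1 2.
rewrite !big_ord4 /= !inter_num0r !inter_num0l !interE /= p130.
clear; lia.
Qed.

Lemma card_scheme3 : #|X| = (1 + 2 * k1 + k3)%N.
Proof.
have [p110 p220 p130 p230] := inter_num_zero.
rewrite (card_scheme S) !big_ord4 /= !inter_num0r !inter_num0l !interE /=.
rewrite p110 p220 p130 p230; clear; lia.
Qed.

End NonsymmetricClass3.

(** * Integer solutions of the Hadamard equations *)

Lemma square_between (m z : nat) : (0 < m)%N -> (z ^ 2 <> m ^ 2 + 4 * m)%N.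
Proof.
move=> m0 e; have: (m + 1 < z < m + 2)%N.
  by apply/andP; split; rewrite -(@ltn_exp2r _ _ 2) // e sqrnD -!mulnn; clear -m0; lia.
lia.
Qed.

(** It excludes w1 + w2 != 0 when w3 = 1; there m is [p231] and D is [p113 - p123]. *)
Lemma no_clique_solution (m D : int) : 0 < m -> 0 < D ->
  8%:Z * m ^+ 3 * D <> (D - m) * ((2%:Z * m - 1) * D - m) ^+ 2.
Proof.
move=> m0 D0 e.
have pos : 0 < 2%:Z * m * D - D + m.
  have : 0 <= (m - 1) * D by apply: mulr_ge0; lia.
  by move: m0 D0; clear; lia.
(* The difference of the two sides factors, and the linear factor is positive by [pos]. *)
have fact : ((2%:Z * m - 1) * D ^+ 2 - 2%:Z * m * (m + 1) * D - m ^+ 2) *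
    (2%:Z * m * D - D + m) = 0.
  rewrite -[RHS](subrr (8%:Z * m ^+ 3 * D)) {1}e; ring.
have {fact} q0 : (2%:Z * m - 1) * D ^+ 2 - 2%:Z * m * (m + 1) * D - m ^+ 2 = 0.
  by move/eqP: fact; rewrite mulf_eq0 (gt_eqF pos) orbF => /eqP.
(* Completing the square in the quadratic for D: m divides Y, and Y / m is a square root of m^2 +
   4m. *)
pose Y := (2%:Z * m - 1) * D - m * (m + 1).
have YE : Y ^+ 2 = m ^+ 2 * (m ^+ 2 + 4%:Z * m).
  have -> : Y ^+ 2 = (2%:Z * m - 1) *
    ((2%:Z * m - 1) * D ^+ 2 - 2%:Z * m * (m + 1) * D - m ^+ 2) +
      m ^+ 2 * (m ^+ 2 + 4%:Z * m) by rewrite /Y; ring.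
  by rewrite q0 mulr0 add0r.
have {}YE : (`|Y| ^ 2 = `|m| ^ 2 * (`|m| ^ 2 + 4 * `|m|))%N.
  rewrite -!abszX YE abszM; congr (_ * _)%N; rewrite abszX -[4%N]/`|4%:Z|%N.
  have {1 2}-> : m = `|m|%N by rewrite gez0_abs // ltW.
  by rewrite -PoszM -rmorphXn -PoszD.
have : (`|m| %| `|Y|)%N by rewrite -(@dvdn_pexp2r _ _ 2) // YE dvdn_mulr.
case/dvdnP => z Yz; apply: (@square_between `|m|%N z); first lia.
apply/eqP; rewrite -(@eqn_pmul2l (`|m| ^ 2)) ?expn_gt0; last lia.
by rewrite -YE Yz expnMn mulnC.
Qed.

(* The last two hypotheses are the Hadamard equations at R1 and R3 multiplied by
   (r + 1)^2, after substituting w1 + w2 = 2 (1 - r) / (r + 1). *)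
Lemma negative_case_parameters (al ga de ep ze mu nu rho si k1 k3 r : int) :
  [/\ 0 <= al, 0 <= ga, 0 <= ep, 0 <= ze & 0 <= si] ->
  [/\ 0 <= mu, 0 <= rho, 0 < k1 & 0 < k3] ->
  [/\ 1 + 2%:Z * al + ga = k1, al + de + ep = k1, ga + ep + ze = k3,
      mu + nu + rho = k1 & 1 + 2%:Z * rho + si = k3] ->
  [/\ k1 * ga = k3 * nu, k1 * ep = k3 * mu & k1 * ze = k3 * rho] ->
  k3 + ze * (al - de) + si * r = r ^+ 2 ->
  r = ga - ep -> 0 < r ->
  4%:Z * (1 - r) * (r + 1) + (al + de) * (4%:Z * (1 - r) ^+ 2 - 2%:Z * (r + 1) ^+ 2)
    + 4%:Z * al * (r + 1) ^+ 2 - 4%:Z * (1 - r) * (r + 1) * (ga + ep)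
    + 2%:Z * ze * (r + 1) ^+ 2 = 0 ->
  mu * (4%:Z * (1 - r) ^+ 2 - 2%:Z * (r + 1) ^+ 2) + 2%:Z * nu * (r + 1) ^+ 2
    - 4%:Z * rho * (1 - r) * (r + 1) + (si - 2%:Z) * (r + 1) ^+ 2 = 0 ->
  [/\ k1 = 5%:Z, k3 = 5%:Z, al = 1, ga = 2%:Z & de = 3%:Z] /\
  [/\ ep = 1, ze = 2%:Z, mu = 1, nu = 2%:Z & si = 0].
Proof.
move=> [al0 ga0 ep0 ze0 si0] [mu0 rho0 k10 k30] [s1 s2 s3 s4 s5] [t1 t2 t3].
move=> ev rE r0 h1 h3.
have epE : ep = ga - r by lia.
have deE : de = al + r + 1 by lia.
pose y := nu - mu; have nuE : nu = mu + y by rewrite /y; ring.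
have ky : k1 * r = k3 * y by rewrite rE /y; lia.
have y0 : 0 < y by rewrite -(pmulr_rgt0 _ k30) -ky mulr_gt0.
(* The equations at R1 and R3 share this expression; it is 0 for r = 1 and too large for [H1] when r
   >= 2. *)
pose c := (r - 1) * ((r - 1) * (1 + 2%:Z * k1 + k3) + 4%:Z * k3 - 4%:Z * r).
have H1 : 4%:Z * ze + c = 4%:Z * r * (r + 1).
  move: h1; rewrite /c -s3 -s1 deE epE; lia.
have H3 : 4%:Z * si - 8%:Z * r + c = - (8%:Z * r * y).
  have rhoE : rho = k1 - mu - nu by lia.
  have k3E : k3 = 1 + 2%:Z * rho + si by lia.
  by move: h3; rewrite /c k3E rhoE nuE; lia.
have dif : ze - si = r ^+ 2 - r + 2%:Z * r * y by lia.
have k3ze : k3 - ze = r ^+ 2 * (r + 2%:Z * y).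
  have : k3 - ze = r ^+ 2 + r * (ze - si) by move: ev; rewrite deE; lia.
  by rewrite dif; lia.
have r1 : r = 1.
  apply/eqP; case: ltgtP (r0 : 1 <= r) => // r2 _; exfalso.
  (* With r >= 2, [k3ze] makes k3 at least r^2 (r + 2), while c >= 5 k3 - 4r; together they exceed
     the right side of [H1]. *)
  have k3ge : r ^+ 2 * (r + 2%:Z) <= k3.
    have : r ^+ 2 * (r + 2%:Z) <= k3 - ze by rewrite k3ze ler_pM2l ?exprn_gt0 //; lia.
    by move/le_trans; apply; lia.
  have n_ge : k3 <= (r - 1) * (1 + 2%:Z * k1 + k3).
    by apply: le_trans (ler_peMl _ _); lia.
  have c_ge : k3 + 4%:Z * k3 - 4%:Z * r <= c.
    apply: le_trans (_ : (r - 1) * (1 + 2%:Z * k1 + k3) + 4%:Z * k3 - 4%:Z * r <= _).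
      by move: n_ge; clear; lia.
    rewrite /c; apply: ler_peMl; last by lia.
    have : r ^+ 2 * 2%:Z <= k3 
      by apply: le_trans k3ge; rewrite ler_pM2l ?exprn_gt0 //; lia.
    have : r <= r ^+ 2 by rewrite expr2 ler_peMl //; lia.
    by move: n_ge k30; clear; lia.
  have : 0 < r ^+ 3 by rewrite exprn_gt0.
  have : 2%:Z * r <= r ^+ 2 by rewrite expr2 ler_pM2r.
  by move: c_ge H1 k3ge ze0 r0; clear; lia.
have ze2 : ze = 2%:Z by move: H1; rewrite /c r1; clear; lia.
have si_0 : si = 0 by move: dif si0 y0; rewrite ze2 r1; clear; lia.
have y1 : y = 1 by move: dif; rewrite ze2 r1 si_0; clear; lia.
have k35 : k3 = 5%:Z by move: k3ze; rewrite r1 y1 ze2; clear; lia.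
have k15 : k1 = 5%:Z by move: ky; rewrite k35 r1 y1; clear; lia.
move: t1 t2 t3 s1 s2 s3 s4 s5 epE; rewrite k15 k35 ze2 r1; clear => *.
split; split; lia.
Qed.

(** The difference is purely imaginary, so its square is minus its squared modulus. *)
Lemma conj_sub_sq_lt0 (C : numClosedFieldType) (z : C) : z != z^* ->
  (z - z^*) ^+ 2 < 0.
Proof.
move=> nz; have -> : (z - z^*) ^+ 2 = - ((z - z^*) * (z - z^*)^*).
  by rewrite rmorphB /= conjCK expr2 -mulrN opprB.
by rewrite oppr_lt0 mul_conjC_gt0 subr_eq0.
Qed.

(** * Elimination of the weights from the Hadamard equations *)

Section WeightCases.
Variables (C : numClosedFieldType) (w1 w2 w3 : C).
(** In order, the Greek letters stand for [p111], [p131], [p221], [p231], [p331], [p113], [p123],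
    [p133], [p333]. *)
Variables (al ga de ep ze mu nu rho si k1 k3 : nat).
Hypothesis w2E : w2 = w1^*.
Hypothesis w12 : w1 * w2 = 1.
Hypothesis w1_neq : w1 != w2.
Hypothesis k1_gt0 : (0 < k1)%N.
Hypothesis k3_gt0 : (0 < k3)%N.
Hypothesis rows :
  [/\ (1 + 2 * al + ga = k1)%N, (al + de + ep = k1)%N, (ga + ep + ze = k3)%N,
      (mu + nu + rho = k1)%N & (1 + 2 * rho + si = k3)%N].
Hypothesis triangles :
  [/\ (k1 * ga = k3 * nu)%N, (k1 * ep = k3 * mu)%N & (k1 * ze = k3 * rho)%N].
Hypothesis eigen : k3%:Z + ze%:Z * (al%:Z - de%:Z) + si%:Z * (ga%:Z - ep%:Z) =
  (ga%:Z - ep%:Z) ^+ 2.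
Hypothesis had1 : 2 * w1 + al%:R * w1 ^+ 2 + de%:R * w2 ^+ 2 + 2 * al%:R * (w1 * w2)
  + 2 * w3 * (ga%:R * w1 + ep%:R * w2) + ze%:R * w3 ^+ 2 = 0.
Hypothesis had2 : 2 * w2 + al%:R * w2 ^+ 2 + de%:R * w1 ^+ 2 + 2 * al%:R * (w1 * w2)
  + 2 * w3 * (ga%:R * w2 + ep%:R * w1) + ze%:R * w3 ^+ 2 = 0.
Hypothesis had3 : 2 * w3 + mu%:R * (w1 ^+ 2 + w2 ^+ 2) + 2 * nu%:R * (w1 * w2)
  + 2 * rho%:R * w3 * (w1 + w2) + si%:R * w3 ^+ 2 = 0.

Let e := w1 + w2.

Lemma e_sq : e ^+ 2 - 2 = w1 ^+ 2 + w2 ^+ 2.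
Proof.
apply/eqP; rewrite -subr_eq0 /e; apply/eqP.
by transitivity (2 * (w1 * w2) - 2); [ring | rewrite w12 mulr1 subrr].
Qed.

(** Swapping w1 and w2 exchanges [had1] and [had2], so their difference is divisible by w1 - w2. *)
Lemma hadamard_diff : 2 + (al%:R - de%:R) * e + 2 * w3 * (ga%:R - ep%:R) = 0.
Proof.
apply: (mulfI (_ : w1 - w2 != 0)); first by rewrite subr_eq0.
by rewrite mulr0 -[RHS](subrr 0) -{1}had1 -had2 /e; ring.
Qed.

Lemma hadamard_sum : w3 ^+ 2 = 1 -> 2 * e + (al%:R + de%:R) * (e ^+ 2 - 2) + 4 * al%:R
  + 2 * w3 * (ga%:R + ep%:R) * e + 2 * ze%:R = 0.
Proof.
move=> w32; rewrite -[RHS](addr0 0) -{1}had1 -had2 w32 w12 e_sq /e; ring.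
Qed.

Lemma hadamard_R3 : w3 ^+ 2 = 1 ->
  2 * w3 + mu%:R * (e ^+ 2 - 2) + 2 * nu%:R + 2 * rho%:R * w3 * e + si%:R = 0.
Proof.
move=> w32; rewrite -[RHS]had3 w32 w12 e_sq /e; ring.
Qed.

Lemma weight3_eqN1 : w3 = -1 ->
  [/\ k1 = 5%N, k3 = 5%N, al = 1%N, ga = 2%N & de = 3%N] /\
  [/\ ep = 1%N, ze = 2%N, mu = 1%N, nu = 2%N & si = 0%N].
Proof.
move=> w3E; have w32 : w3 ^+ 2 = 1 by rewrite w3E sqrrN expr1n.
have [s1 s2 s3 s4 s5] := rows; have [t1 t2 t3] := triangles.
have [r rE] : exists r : int, r = ga%:Z - ep%:Z by exists (ga%:Z - ep%:Z).
have rC : r%:~R = ga%:R - ep%:R :> C by rewrite rE rmorphB.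
have dE : al%:R - de%:R = - (r%:~R + 1) :> C.
  have -> : r%:~R + 1 = (r + 1)%:~R :> C by rewrite intrD.
  rewrite -rmorphN (_ : - (r + 1) = al%:Z - de%:Z); first by rewrite rmorphB.
  by rewrite rE; lia.
have te : (r%:~R + 1) * e = 2 * (1 - r%:~R).
  apply/eqP; rewrite -subr_eq0 -oppr_eq0 -[X in _ == X]hadamard_diff w3E dE rC.
  by apply/eqP; ring.
have esq : e ^+ 2 < 4.
  have : w1 != w1^* by rewrite -w2E.
  move/conj_sub_sq_lt0; rewrite -w2E.
  have -> : (w1 - w2) ^+ 2 = e ^+ 2 - 4 * (w1 * w2) by rewrite /e; ring.
  by rewrite w12 mulr1 subr_lt0.
have t_neq0 : (r%:~R + 1 : C) != 0.
  apply/eqP => t0; move: te; rewrite t0 mul0r => /esym h.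
  have : (4%:R : C) = 2 * (1 - r%:~R) + 2 * (r%:~R + 1) by ring.
  by rewrite h t0 mulr0 addr0 => /eqP; rewrite pnatr_eq0.
have r_gt0 : 0 < r.
  rewrite -(ltr0z C) -(@pmulr_rgt0 _ 16%:R) ?ltr0n //.
  (* By [te] the right side is 4 (r + 1)^2 - 4 (1 - r)^2. *)
  have -> : 16%:R * r%:~R = (r%:~R + 1) ^+ 2 * (4 - e ^+ 2) :> C.
    by rewrite mulrBr -exprMn te; ring.
  apply: mulr_gt0; last by rewrite subr_gt0.
  by rewrite real_exprn_even_gt0 ?t_neq0 ?orbT // realD ?real1 // realz.
have eE : e = 2 * (1 - r%:~R) / (r%:~R + 1) by rewrite -te mulrC mulKf.
have nn1 : [/\ 0 <= al%:Z, 0 <= ga%:Z, 0 <= ep%:Z, 0 <= ze%:Z & 0 <= si%:Z] by [].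
have nn2 : [/\ 0 <= mu%:Z, 0 <= rho%:Z, 0 < k1%:Z & 0 < k3%:Z] by [].
have z1 : [/\ 1 + 2%:Z * al%:Z + ga%:Z = k1, al%:Z + de%:Z + ep%:Z = k1,
    ga%:Z + ep%:Z + ze%:Z = k3, mu%:Z + nu%:Z + rho%:Z = k1 &
    1 + 2%:Z * rho%:Z + si%:Z = k3] by split; lia.
have z2 : [/\ k1%:Z * ga%:Z = k3%:Z * nu%:Z, k1%:Z * ep%:Z = k3%:Z * mu%:Z &
    k1%:Z * ze%:Z = k3%:Z * rho%:Z] by split; lia.
have ev := eigen; rewrite -rE in ev.
have [] := negative_case_parameters nn1 nn2 z1 z2 ev rE r_gt0.
- apply/eqP; rewrite -(intr_eq0 C); apply/eqP.
  have := hadamard_sum w32; rewrite w3E eE => H.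
  by rewrite -[RHS](mulr0 ((r%:~R + 1) ^+ 2)) -H; field.
- apply/eqP; rewrite -(intr_eq0 C); apply/eqP.
  have := hadamard_R3 w32; rewrite w3E eE => H.
  by rewrite -[RHS](mulr0 ((r%:~R + 1) ^+ 2)) -H; field.
- by move=> [? ? ? ? ?] [? ? ? ? ?]; split; split; lia.
Qed.

Lemma weight3_eq1 : w3 = 1 ->
  w1 + w2 = 0 /\ exists a : nat, [/\ (0 < a)%N, k3.+1 = (2 * a)%N,
    k1 = (a * k3)%N, mu = (nu + a)%N & [/\ si.+1 = k3, rho = 0%N, ze = 0%N & de = al]].
Proof.
move=> w3E; have w32 : w3 ^+ 2 = 1 by rewrite w3E expr1n.
have [s1 s2 s3 s4 s5] := rows; have [t1 t2 t3] := triangles.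
have e_neq2 : e != 2.
  apply: contra w1_neq => /eqP e2; rewrite -subr_eq0 -sqrf_eq0.
  have -> : (w1 - w2) ^+ 2 = e ^+ 2 - 4 * (w1 * w2) by rewrite /e; ring.
  by rewrite e2 w12; apply/eqP; ring.
(* The first two row sums give ga - ep = de - al - 1, which turns [hadamard_diff] into (al - de)(e -
   2) = 0. *)
have de_al : de = al.
  apply/eqP; rewrite -(eqr_nat C) eq_sym -subr_eq0.
  have : (al%:R - de%:R) * (e - 2) = 0 :> C.
    rewrite -[RHS]hadamard_diff w3E.
    have -> : ga%:R - ep%:R = de%:R - al%:R - 1 :> C.
      apply/eqP; rewrite -subr_eq0; apply/eqP.
      transitivity ((1 + al + ga)%:R - (de + ep)%:R :> C); first by ring.
      by apply/eqP; rewrite subr_eq0 eqr_nat; apply/eqP; lia.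
    by ring.
  by move/eqP; rewrite mulf_eq0 [_ - 2 == 0]subr_eq0 (negPf e_neq2) orbF.
have ep_ga : ep = ga.+1 by lia.
have si_k3 : si.+1 = k3 by move: eigen; rewrite de_al ep_ga; clear; lia.
have rho0 : rho = 0%N by lia.
have ze0 : ze = 0%N.
  by apply/eqP; rewrite -(eqn_pmul2l k1_gt0) t3 rho0 !muln0.
have k1E : (k1 + k3 * nu = k3 * mu)%N by move: t1 t2; rewrite ep_ga; clear; lia.
have le_numu : (nu <= mu)%N by rewrite -(leq_pmul2l k3_gt0) -k1E leq_addl.
(* This difference becomes the parameter a; subtracting the first two triangle identities gave k1 =
   D k3. *)
pose D := (mu - nu)%N; have muE : mu = (nu + D)%N by rewrite /D subnKC.
have k1D : k1 = (D * k3)%N by move: k1E; rewrite muE; clear; lia.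
have D0 : (0 < D)%N by move: k1_gt0; rewrite k1D; case: (D).
have tie := hadamard_R3 w32; have := hadamard_sum w32.
rewrite w3E de_al ep_ga ze0 => sum.
have : e * (al%:R * e + 2 * ga.+1%:R) = 0.
  by apply: (mulfI (_ : 2%:R != 0 :> C)); rewrite ?pnatr_eq0 // mulr0 -sum; ring.
move/eqP; rewrite mulf_eq0 => /orP[/eqP e0|/eqP ale].
  (* With e = 0 the equation at R3 reduces to k3 + 1 = 2 D. *)
  split=> //; exists D; split=> //; last first.
    apply/eqP; rewrite -(eqr_nat C) -subr_eq0 -[X in _ == X]tie w3E e0 rho0 muE -si_k3.
    by apply/eqP; ring.
(* In the other case put m = ga + 1. Then al e = -2m and mu e^2 = 2 (D - m), and eliminating e gives
   the excluded equation. *)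
exfalso; apply: (@no_clique_solution ga.+1 D) => //.
apply/eqP; rewrite -subr_eq0 -(intr_eq0 C); apply/eqP.
have alE : 2 * al%:R = (2 * ga.+1%:R - 1) * D%:R - ga.+1%:R :> C.
  apply/eqP; rewrite -subr_eq0; apply/eqP.
  transitivity ((2 * al + ga.+1 + D)%:R - (2 * ga.+1 * D)%:R :> C); first by ring.
  by apply/eqP; rewrite subr_eq0 eqr_nat; apply/eqP; lia.
have mu_e2 : mu%:R * e ^+ 2 = 2 * (D%:R - ga.+1%:R) :> C.
  apply/eqP; rewrite -subr_eq0 -[X in _ == X]tie w3E rho0; apply/eqP.
  have -> : si = (2 * ga)%N by lia.
  by rewrite muE; ring.
have muD : mu = (ga.+1 * D)%N by lia.
have aleE : al%:R * e = - (2 * ga.+1%:R) :> C by apply/eqP; rewrite -addr_eq0 ale.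
have : 2 * (mu%:R * (al%:R * e) ^+ 2) = (2 * al%:R) ^+ 2 * (D%:R - ga.+1%:R) :> C.
  transitivity (2 * al%:R ^+ 2 * (mu%:R * e ^+ 2)); first by ring.
  by rewrite mu_e2; ring.
rewrite aleE alE muD => h.
have -> : (8%:Z * ga.+1%:Z ^+ 3 * D%:Z -
   (D%:Z - ga.+1%:Z) * ((2%:Z * ga.+1%:Z - 1) * D%:Z - ga.+1%:Z) ^+ 2)%:~R =
   2 * ((ga.+1 * D)%:R * (- (2 * ga.+1%:R)) ^+ 2) -
   ((2 * ga.+1%:R - 1) * D%:R - ga.+1%:R) ^+ 2 * (D%:R - ga.+1%:R) :> C by ring.
by rewrite h subrr.
Qed.

End WeightCases.

(** * Primitive idempotents *)

Section PrimitiveIdempotents.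
Variables (C : numClosedFieldType) (X : finType) (d : nat).
Variable S : assoc_scheme X d.
Local Notation A := (adj C S).

Lemma bose_mesner_adj k : in_bose_mesner S (A k).
Proof.
exists (fun l => (l == k)%:R); rewrite (bigD1 k) //= eqxx scale1r big1 ?addr0 //.
by move=> l /negPf ->; rewrite scale0r.
Qed.

Lemma bose_mesnerD M N : in_bose_mesner S M -> in_bose_mesner S N ->
  in_bose_mesner (C := C) S (M + N).
Proof.
move=> [c ->] [c' ->]; exists (fun l => c l + c' l).
by rewrite -big_split; apply: eq_bigr => l _; rewrite scalerDl.
Qed.

Lemma bose_mesnerZ a M : in_bose_mesner S M -> in_bose_mesner (C := C) S (a *: M).
Proof.
move=> [c ->]; exists (fun l => a * c l).
by rewrite scaler_sumr; apply: eq_bigr => l _; rewrite scalerA.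
Qed.

Lemma bose_mesnerB M N : in_bose_mesner S M -> in_bose_mesner S N ->
  in_bose_mesner (C := C) S (M - N).
Proof. by move=> bM bN; rewrite -scaleN1r; apply/bose_mesnerD/bose_mesnerZ. Qed.

Variables (E : 'I_d.+1 -> 'M[C]_#|X|) (P : 'M[C]_d.+1).
Hypothesis E_orth : forall i j, E i *m E j = if i == j then E i else 0.
Hypothesis E_neq0 : forall i, E i != 0.
Hypothesis E_bm : forall i, in_bose_mesner S (E i).
Hypothesis E0 : E ord0 = #|X|%:R^-1 *: const_mx 1.
Hypothesis E_P : first_eigenmatrix S E P.

Lemma bose_mesner_idem M : in_bose_mesner S M ->
  exists e : 'I_d.+1 -> C, M = \sum_k e k *: E k.
Proof.
move=> [c ->]; exists (fun k => \sum_j c j * P k j).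
under eq_bigr => j _ do rewrite E_P scaler_sumr.
rewrite exchange_big; apply: eq_bigr => k _.
by rewrite scaler_suml; apply: eq_bigr => j _; rewrite scalerA.
Qed.

Lemma idem_coef e k :
  (E k *m (\sum_l e l *: E l) = e k *: E k) *
  ((\sum_l e l *: E l) *m E k = e k *: E k).
Proof.
split.
- rewrite mulmx_sumr (bigD1 k) //= -scalemxAr E_orth eqxx big1 ?addr0 // => l lk.
  by rewrite -scalemxAr E_orth eq_sym (negPf lk) scaler0.
- rewrite mulmx_suml (bigD1 k) //= -scalemxAl E_orth eqxx big1 ?addr0 // => l lk.
  by rewrite -scalemxAl E_orth (negPf lk) scaler0.
Qed.

Lemma idem_coef01 e k : let M := \sum_l e l *: E l in M *m M = M ->
  e k = 0 \/ e k = 1.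
Proof.
move=> M MM; have := mulmxA (E k) M M; rewrite MM !idem_coef.
rewrite -scalemxAl idem_coef scalerA => /eqP.
rewrite -subr_eq0 -scalerBl scaler_eq0 (negPf (E_neq0 k)) orbF.
rewrite -{1}[e k]mulr1 -mulrBr mulf_eq0 subr_eq0 => /orP[/eqP|/eqP]; first by left.
by right.
Qed.

(** The eigenmatrix shows that the [E k] span the algebra, and by orthogonality an idempotent has
    coefficients 0 or 1 on them. *)
Lemma primitive_idempotentsP : primitive_idempotents S E.
Proof.
have Eidem k : bm_idempotent S (E k) by split; rewrite // E_orth eqxx.
split=> // [i j Eij|M].
  apply/eqP; apply: contraT => ij; have := E_orth i j.
  rewrite (negPf ij) -Eij E_orth eqxx => Ei0.
  by have := E_neq0 i; rewrite Ei0 eqxx.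
split=> [[[bM MM] M0 Mprim]|[k ->]].
  have [e Me] := bose_mesner_idem bM.
  have [k ek] : exists k, e k != 0.
    apply/existsP; rewrite -negb_forall; apply: contra M0 => /forallP e0.
    by rewrite Me big1 // => k _; rewrite (eqP (e0 k)) scale0r.
  exists k; have e1 : e k = 1.
    by move: MM; rewrite Me => /(@idem_coef01 e k)[] // e0; rewrite e0 eqxx in ek.
  have MEk : (E k *m M = E k) * (M *m E k = E k) by rewrite Me !idem_coef e1 scale1r.
  (* Primitivity is applied to the splitting of M into [E k] and [M - E k]. *)
  have [//|||||Ek0|/eqP] := Mprim (E k) (M - E k).
  - split; first exact: bose_mesnerB.
    by rewrite mulmxBl !mulmxBr MM !MEk E_orth eqxx subrr subr0.
  - by rewrite mulmxBr MEk E_orth eqxx subrr.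
  - by rewrite mulmxBl MEk E_orth eqxx subrr.
  - by rewrite addrC subrK.
  - by have := E_neq0 k; rewrite Ek0 eqxx.
  - by rewrite subr_eq0 => /eqP.
split=> // F G [bF FF] [bG GG] FG GF EFG.
have [f Ff] := bose_mesner_idem bF.
(* Multiplying F by [E k = F + G] fixes F, yet keeps only its k-th component. *)
have EF : F = f k *: E k.
  by rewrite -(idem_coef f k).1 -Ff EFG mulmxDl FF GF addr0.
have [f0|f1] : f k = 0 \/ f k = 1 by move: FF; rewrite {1 2 3}Ff; apply: idem_coef01.
- by left; rewrite EF f0 scale0r.
- right; move: EFG; rewrite EF f1 scale1r => /eqP.
  by rewrite -{1}[E k]addr0 => /eqP/addrI.
Qed.

End PrimitiveIdempotents.

(** * Four orthogonal idempotents from two nested projections and an involution *)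

Section SplitIdempotents.
Variables (C : numClosedFieldType) (n : nat) (J K B : 'M[C]_n).
Hypotheses (JJ : J *m J = J) (JK : J *m K = J) (KJ : K *m J = J) (KK : K *m K = K).
Hypotheses (JB : J *m B = 0) (BJ : B *m J = 0) (KB : K *m B = 0) (BK : B *m K = 0).
Hypothesis BB : B *m B = 1%:M - K.

(** B is an involution on the range of 1 - K; the middle two entries project onto its eigenspaces
    for -1 and 1, in this order. *)
Definition split_idem (k : 'I_4) : 'M[C]_n :=
  nth 0 [:: J; 2^-1 *: (1%:M - K - B); 2^-1 *: (1%:M - K + B); K - J] k.

Lemma split_idem_orth i j :
  split_idem i *m split_idem j = if i == j then split_idem i else 0.
Proof.
rewrite /split_idem; case: i => [[|[|[|[|//]]]] ?]; case: j => [[|[|[|[|//]]]] ?] /=;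
rewrite -?scalemxAl -?scalemxAr ?(mulmxBl, mulmxDl) ?(mulmxBr, mulmxDr) ?(mulNmx, mulmxN);
rewrite ?(JJ, JK, KJ, KK, JB, BJ, KB, BK, BB, mul1mx, mulmx1);
by apply/matrixP => x y; rewrite ?mxE; field.
Qed.

End SplitIdempotents.

(** * The clique scheme *)

Section Cliques.
Variables (X : finType) (e : rel X) (s m : nat).
Hypothesis e_irr : irreflexive e.
Hypothesis e_sym : symmetric e.
Hypothesis e_trans : forall x y z, e x y -> e y z -> (x == z) || e x z.
Hypothesis e_deg : forall x, #|[set z | e x z]|.+1 = s.
Hypothesis s_gt0 : (0 < s)%N.
Hypothesis cardX : #|X| = (m * s)%N.

(** Being equal or adjacent is an equivalence relation; its classes have s points by [e_deg], and
    [cardX] gives their number. *)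
Lemma disjoint_cliquesP : disjoint_cliques e m s.
Proof.
pose r x y := (x == y) || e x y.
have r_eq : {in [set: X] & &, equivalence_rel r}.
  move=> x y z _ _ _; rewrite /r eqxx; split=> // /predU1P[-> // | xy].
  have yx : e y x by rewrite e_sym.
  apply/idP/idP => /predU1P[<-|h]; rewrite ?yx ?xy ?orbT //; first exact: e_trans yx h.
  exact: e_trans xy h.
have parP := equivalence_partitionP r_eq.
set Q := equivalence_partition r [set: X] in parP.
have pbE x y : (y \in pblock Q x) = r x y by apply: pblock_equivalence_partition.
have cardB B : B \in Q -> #|B| = s.
  move=> BQ; have [x xB] : exists x, x \in B.
    apply/set0Pn; apply: contraTneq BQ => ->.
    by case/and3P: parP.
  have -> : B = x |: [set z | e x z].
    have -> : B = pblock Q x by rewrite (def_pblock _ BQ xB) //; case/and3P: parP.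
    by apply/setP => z; rewrite pbE !inE eq_sym.
  by rewrite cardsU1 inE e_irr add1n e_deg.
exists Q; split=> //.
  apply/eqP; rewrite -(eqn_pmul2r s_gt0) -cardX -cardsT.
  by rewrite (card_uniform_partition cardB parP).
move=> x y; rewrite eq_pblock; last 2 first.
- by case/and3P: parP.
- by case/and3P: parP => /eqP -> _ _; rewrite inE.
rewrite pbE /r; case: eqP => [->|]; first by rewrite e_irr.
by [].
Qed.
End Cliques.

Section CliqueScheme.
Variables (C : numClosedFieldType) (X : finType) (S : assoc_scheme X 3) (a : nat).
Hypothesis S_comm : commutative_scheme S.
Hypothesis R1_transpose : forall x y, S 2 x y = S 1 y x.
Hypothesis R3_sym : symmetric (S 3).
Local Notation p := (inter_num S).
Local Notation k1 := (p 1 2 ord0).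
Local Notation k3 := (p 3 3 ord0).
Local Notation p111 := (p 1 1 1).
Local Notation p221 := (p 2 2 1).
Local Notation p331 := (p 3 3 1).
Local Notation p113 := (p 1 1 3).
Local Notation p123 := (p 1 2 3).
Local Notation p133 := (p 1 3 3).
Local Notation p333 := (p 3 3 3).
Hypothesis a_gt0 : (0 < a)%N.
Hypothesis k3E : k3.+1 = (2 * a)%N.
Hypothesis k1E : k1 = (a * k3)%N.
Hypothesis p113E : p113 = (p123 + a)%N.
Hypothesis p333E : p333.+1 = k3.
Hypothesis p133E : p133 = 0%N.
Hypothesis p331E : p331 = 0%N.
Hypothesis p221E : p221 = p111.
Local Notation A := (adj C S).

Lemma cardX_clique : #|X| = (2 * a * (2 * a))%N.
Proof. by rewrite (card_scheme3 S_comm R1_transpose) k1E mulnA -k3E; clear; lia. Qed.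

(** Since [p331] and its transpose [p 3 3 2] vanish, two steps in R3 lead back to the start or to an
    R3-neighbour. *)
Lemma R3_cliques : disjoint_cliques (S 3) (2 * a) (2 * a).
Proof.
have zero x y z k : p 3 3 k = 0%N -> S k x y -> S 3 x z -> S 3 z y -> False.
  move=> p0 kxy xz zy; have := scheme_inter 3 3 kxy; rewrite p0 => /eqP.
  by rewrite cards_eq0 => /eqP/setP/(_ z); rewrite !inE xz zy.
apply: disjoint_cliquesP => //.
- by move=> x; apply/negP => xx; have := scheme_eq_rel ord0 xx; rewrite scheme_diag eqxx.
- move=> x y z xy yz; have [k] := scheme_cover S x z; move: k; apply: ord4P.
  + by rewrite scheme_diag => ->.
  + by move=> xz; case: (zero _ _ _ _ p331E xz xy yz).
  + have p332E : p 3 3 2 = 0%N by rewrite (inter332 R1_transpose R3_sym).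
    by move=> xz; case: (zero _ _ _ _ p332E xz xy yz).
  + by move=> ->; rewrite orbT.
- move=> x; rewrite -k3E; congr _.+1; have xx : S ord0 x x by rewrite scheme_diag.
  rewrite -(scheme_inter 3 3 xx); apply: eq_card => z.
  by rewrite !inE R3_sym [in RHS]R3_sym andbb.
- by rewrite muln_gt0.
- exact: cardX_clique.
Qed.

Let al : C := a%:R.
Let al_neq0 : al != 0. Proof. by rewrite pnatr_eq0 -lt0n. Qed.

Lemma values : [/\ k3%:R = 2 * al - 1 :> C, k1%:R = al * (2 * al - 1) :> C,
   p111%:R = al * (al - 1) :> C, (p 1 3 1)%:R = al - 1 :> C & (p 2 3 1)%:R = al :> C] /\
  [/\ p113%:R = al ^+ 2 :> C, p123%:R = al * (al - 1) :> C & p333%:R = 2 * al - 2 :> C].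
Proof.
have [s1 s2 s3 s4 s5] := row_sums S_comm R1_transpose R3_sym.
move: s1 s2 s3 s4 s5 k1E; rewrite p331E p133E p221E p113E => s1 s2 s3 s4 s5 s6.
have p231E : p 2 3 1 = a by lia.
(* The equations in [nat] are kept additive because subtraction truncates; [pred] and [sub] carry
   them to C. *)
have p131E : (p 1 3 1).+1 = a by lia.
have p111E : (p111 + a = a * a)%N by nia.
have p123E : (p123 + a = a * a)%N by nia.
have pred n m : (n + 1 = m)%N -> n%:R = m%:R - 1 :> C.
  by move=> <-; rewrite natrD addrK.
have sub n m : (n + a = m)%N -> n%:R = m%:R - al :> C.
  by move=> <-; rewrite natrD addrK.
have k3C : k3%:R = 2 * al - 1 :> C by rewrite (pred _ (2 * a)%N) ?addn1 // natrM.
split; split.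
- exact: k3C.
- by rewrite s6 natrM k3C.
- by rewrite (sub _ _ p111E) natrM /al; ring.
- by rewrite (pred _ a) ?addn1.
- by rewrite p231E.
- by rewrite p123E natrM expr2.
- by rewrite (sub _ _ p123E) natrM /al; ring.
- by rewrite (pred _ k3) ?addn1 // k3C; ring.
Qed.

Lemma adj_mul_table :
  [/\ A 3 *m A 3 = (2 * al - 1) *: A ord0 + (2 * al - 2) *: A 3,
      A 1 *m A 3 = (al - 1) *: A 1 + al *: A 2,
      A 3 *m A 1 = (al - 1) *: A 1 + al *: A 2,
      A 2 *m A 3 = al *: A 1 + (al - 1) *: A 2 &
      A 3 *m A 2 = al *: A 1 + (al - 1) *: A 2] /\
  [/\ A 1 *m A 1 = (al * (al - 1)) *: (A 1 + A 2) + al ^+ 2 *: A 3,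
      A 2 *m A 2 = (al * (al - 1)) *: (A 1 + A 2) + al ^+ 2 *: A 3,
      A 1 *m A 2 = (al * (2 * al - 1)) *: A ord0 + (al * (al - 1)) *: (A 1 + A 2 + A 3) &
      A 2 *m A 1 = (al * (2 * al - 1)) *: A ord0 + (al * (al - 1)) *: (A 1 + A 2 + A 3)].
Proof.
have [[k3C k1C p111C p131C p231C] [p113C p123C p333C]] := values.
have [p110 p220 p130 p230] := inter_num_zero R1_transpose.
split; split; rewrite adj_mul !big_ord4 /= !interE //;
  rewrite ?p110 ?p220 ?p130 ?p230 ?p221E ?p331E ?p133E;
  rewrite ?k3C ?k1C ?p111C ?p131C ?p231C ?p113C ?p123C ?p333C;
  by apply/matrixP => i j; rewrite !mxE; ring.
Qed.

(** J averages over all (2a)^2 points and K over each clique. B is scaled to square to 1 - K, and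
    its eigenvalue -1 goes with the eigenvalue ai of [A 1], which fixes the order of the
    idempotents. *)
Let J := (2 * al) ^- 2 *: (A ord0 + (A 1 + (A 2 + A 3))).
Let K := (2 * al)^-1 *: (A ord0 + A 3).
Let B := ('i / (2 * al)) *: (A 1 - A 2).

Lemma split_rels :
  [/\ J *m J = J, J *m K = J, K *m J = J & K *m K = K] /\
  [/\ J *m B = 0, B *m J = 0, K *m B = 0, B *m K = 0 & B *m B = 1%:M - K].
Proof.
have [[T33 T13 T31 T23 T32] [T11 T22 T12 T21]] := adj_mul_table.
have i2 : 'i ^+ 2 = -1 :> C := sqrCi _.
have two_neq0 : (2 : C) != 0 by rewrite pnatr_eq0.
split; split; rewrite /J /K /B -?adj0 -?scalemxAl -?scalemxAr ?scalerA
    ?(mulmxBl, mulmxDl) ?(mulmxBr, mulmxDr) ?(mulNmx, mulmxN);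
  rewrite ?(T33, T13, T31, T23, T32, T11, T22, T12, T21) adj0 ?(mul1mx, mulmx1);
  apply/matrixP => i j; rewrite ?mxE.
all: try by field.
(* The goal left is [B *m B = 1%:M - K], where the square of i enters. *)
have -> : 'i / (2 * al) * ('i / (2 * al)) = - (2 * al) ^- 2.
  by rewrite mulf_div -expr2 i2 mulN1r expr2.
by field.
Qed.

Let E := split_idem J K B.

Lemma E_orth i j : E i *m E j = if i == j then E i else 0.
Proof. by have [[? ? ? ?] [? ? ? ? ?]] := split_rels; apply: split_idem_orth. Qed.

Lemma E_bm i : in_bose_mesner S (E i).
Proof.
have bA k := bose_mesner_adj C S k.
have bJ : in_bose_mesner S J by do ![apply: bose_mesnerZ | apply: bose_mesnerD].
have bK : in_bose_mesner S K by do ![apply: bose_mesnerZ | apply: bose_mesnerD].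
have bB : in_bose_mesner S B by apply/bose_mesnerZ/bose_mesnerB.
have b1K : in_bose_mesner S (1%:M - K) by rewrite -(adj0 C S); apply: bose_mesnerB.
move: i; apply: ord4P => //.
- exact/bose_mesnerZ/bose_mesnerB.
- exact/bose_mesnerZ/bose_mesnerD.
- exact: bose_mesnerB.
Qed.

Lemma E_neq0 i : E i != 0.
Proof.
have [x _] := scheme_nonempty S ord0; have xx : S ord0 x x by rewrite scheme_diag.
have Sx k : S k x x = (k == ord0) by rewrite (scheme_eq_rel k xx).
have t0 : 2 * al != 0 by rewrite mulf_neq0 // pnatr_eq0.
have t1 : 1 - (2 * al)^-1 != 0.
  rewrite subr_eq0 eq_sym invr_eq1 /al -natrM pnatr_eq1; lia.
(* Only [A ord0] contributes to a diagonal entry, and its coefficients are nonzero because 2a is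
   neither 0 nor 1. *)
suff h : E i (enum_rank x) (enum_rank x) != 0.
  by apply: contraNneq h => ->; rewrite mxE.
move: i; apply: ord4P; rewrite /E /split_idem /= /J /K /B -?(adj0 C S);
  rewrite !mxE !enum_rankK !Sx /=.
- by rewrite !addr0 mulr1 invr_neq0 // expf_neq0.
- by rewrite addr0 mulr1 subrr mulr0 subr0 mulf_neq0 // invr_neq0 // pnatr_eq0.
- by rewrite addr0 mulr1 subrr mulr0 addr0 mulf_neq0 // invr_neq0 // pnatr_eq0.
- rewrite !addr0 !mulr1 (_ : _ - _ = (2 * al)^-1 * (1 - (2 * al)^-1)).
    by rewrite mulf_neq0 // invr_neq0.
  by field.
Qed.

Lemma E_ord0 : E ord0 = #|X|%:R^-1 *: const_mx 1.
Proof.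
have cX : #|X|%:R = (2 * al) ^+ 2 :> C by rewrite cardX_clique natrM natrM -expr2.
by rewrite -(sum_adj C S) big_ord4 cX.
Qed.

Lemma E_eigenmatrix : first_eigenmatrix S E (eigenmatrix_cliques C a).
Proof.
have i2 : 'i * 'i = -1 :> C by rewrite -expr2 sqrCi.
have two_neq0 : (2 : C) != 0 by rewrite pnatr_eq0.
apply: ord4P; rewrite big_ord4 !mxE /= -/al /E /split_idem /= -(adj0 C S) /J /K /B;
  apply/matrixP => i j; rewrite !mxE.
- by field.
- set s1 := (S 1 _ _)%:R; set s2 := (S 2 _ _)%:R; symmetry.
  by transitivity ((s1 + s2) / 2 - 'i * 'i * (s1 - s2) / 2); [field | rewrite i2; field].
- set s1 := (S 1 _ _)%:R; set s2 := (S 2 _ _)%:R; symmetry.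
  by transitivity ((s1 + s2) / 2 + 'i * 'i * (s1 - s2) / 2); [field | rewrite i2; field].
- by field.
Qed.

Lemma clique_eigenmatrix : exists E : 'I_4 -> 'M[C]_#|X|,
  primitive_idempotents S E /\ first_eigenmatrix S E (eigenmatrix_cliques C a).
Proof.
exists E; split; last exact: E_eigenmatrix.
exact: primitive_idempotentsP E_orth E_neq0 E_bm E_ord0 E_eigenmatrix.
Qed.

End CliqueScheme.

(** * Hermitian Hadamard matrices *)

(** For hermitian W the Hadamard condition reads W^2 = n I, whose coefficients off the diagonal
    relation vanish. *)
Lemma hadamard_coeffs (C : numClosedFieldType) (X : finType) d
    (S : assoc_scheme X d) (w : 'I_d.+1 -> C) (W := \sum_k w k *: adj C S k) :
  W *m W = #|X|%:R%:M -> forall k, k != ord0 ->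
  \sum_i \sum_j w i * w j * (inter_num S i j k)%:R = 0.
Proof.
rewrite /W adj_comb_mul => WW k k0.
have : #|X|%:R%:M = \sum_k (if k == ord0 then #|X|%:R else 0 : C) *: adj C S k.
  rewrite (bigD1 ord0) //= big1 ?addr0 => [|l /negPf ->]; last by rewrite scale0r.
  by rewrite adj0 scalemx1.
by rewrite -WW => /adj_free/(_ k) ->; rewrite (negPf k0).
Qed.

Section Weights.
Local Open Scope sesquilinear_scope.
Variables (C : numClosedFieldType) (X : finType) (S : assoc_scheme X 3).
Variables (w : 'I_4 -> C) (W : 'M[C]_#|X|).
Hypothesis S_comm : commutative_scheme S.
Hypothesis R1_transpose : forall x y, S 2 x y = S 1 y x.
Hypothesis R3_sym : symmetric (S 3).
Hypothesis w0 : w 0 = 1.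
Hypothesis w_abs : forall k, `|w k| = 1.
Hypothesis W_def : W = \sum_(k < 4) w k *: adj C S k.
Hypothesis W_herm : W \is hermsymmx.
Hypothesis W_hadamard : complex_hadamard W.
Hypothesis W_not_real : ~ real_hadamard W.
Local Notation p := (inter_num S).

Lemma W_conj : W = W^t*.
Proof. by move/is_hermitianmxP: W_herm; rewrite expr0 scale1r. Qed.

Lemma w_conj k l x y : S k x y -> S l y x -> w k = (w l)^*.
Proof.
move=> kxy lyx; rewrite -(adj_comb_entry w kxy) -(adj_comb_entry w lyx) -W_def.
by rewrite {1}W_conj !mxE.
Qed.

Lemma w2_conj : w 2 = (w 1)^*.
Proof.
have [x [y xy]] := scheme_nonempty S 1; apply: (@w_conj 2 1 y x) => //.
by rewrite R1_transpose.
Qed.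

Lemma w3_sq : w 3 = 1 \/ w 3 = -1.
Proof.
have [x [y xy]] := scheme_nonempty S 3.
have w3c : w 3 = (w 3)^* by apply: (w_conj xy); rewrite R3_sym.
have : w 3 ^+ 2 == 1 by rewrite expr2 {2}w3c -normCK w_abs expr1n.
by rewrite sqrf_eq1 => /orP[] /eqP; [left | right].
Qed.

Lemma w12_eq1 : w 1 * w 2 = 1.
Proof. by rewrite w2_conj -normCK w_abs expr1n. Qed.

(** As w2 is the conjugate of w1, equality would make both real; w3 is 1 or -1, so W would be a real
    Hadamard matrix. *)
Lemma w1_neq_w2 : w 1 != w 2.
Proof.
apply/eqP => w12; apply: W_not_real; split=> //; apply/mxOverP => i j.
have w_real : forall k, w k \is Num.real.
  apply: ord4P; first by rewrite (w0 : w ord0 = 1) real1.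
  - by rewrite CrealE -w2_conj w12.
  - by rewrite CrealE w2_conj conjCK -w2_conj w12.
  - by case: w3_sq => ->; rewrite ?realN real1.
rewrite -(enum_valK i) -(enum_valK j).
have [k kxy] := scheme_cover S (enum_val i) (enum_val j).
by rewrite W_def (adj_comb_entry w kxy).
Qed.

Lemma hadamard_eqs :
  [/\ 2 * w 1 + (p 1 1 1)%:R * w 1 ^+ 2 + (p 2 2 1)%:R * w 2 ^+ 2
        + 2 * (p 1 1 1)%:R * (w 1 * w 2)
        + 2 * w 3 * ((p 1 3 1)%:R * w 1 + (p 2 3 1)%:R * w 2)
        + (p 3 3 1)%:R * w 3 ^+ 2 = 0,
      2 * w 2 + (p 1 1 1)%:R * w 2 ^+ 2 + (p 2 2 1)%:R * w 1 ^+ 2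
        + 2 * (p 1 1 1)%:R * (w 1 * w 2)
        + 2 * w 3 * ((p 1 3 1)%:R * w 2 + (p 2 3 1)%:R * w 1)
        + (p 3 3 1)%:R * w 3 ^+ 2 = 0 &
      2 * w 3 + (p 1 1 3)%:R * (w 1 ^+ 2 + w 2 ^+ 2)
        + 2 * (p 1 2 3)%:R * (w 1 * w 2) + 2 * (p 1 3 3)%:R * w 3 * (w 1 + w 2)
        + (p 3 3 3)%:R * w 3 ^+ 2 = 0].
Proof.
have WW : W *m W = #|X|%:R%:M by case: W_hadamard => _; rewrite -W_conj.
rewrite W_def in WW; have H := hadamard_coeffs WW.
split.
- have := H 1 isT; rewrite !big_ord4 /= !inter_num0r !inter_num0l !interE // /=.
  by rewrite (w0 : w ord0 = 1) => h; rewrite -[RHS]h; ring.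
- have := H 2 isT; rewrite !big_ord4 /= !inter_num0r !inter_num0l !interE // /=.
  by rewrite (w0 : w ord0 = 1) => h; rewrite -[RHS]h; ring.
- have := H 3 isT; rewrite !big_ord4 /= !inter_num0r !inter_num0l !interE // /=.
  by rewrite (w0 : w ord0 = 1) => h; rewrite -[RHS]h; ring.
Qed.

End Weights.

(* R3 would be the Clebsch graph and R1 an orientation of its complement. *)
Lemma no_scheme16 (X : finType) (S : assoc_scheme X 3)
    (R1_transpose : forall x y, S 2 x y = S 1 y x) (R3_sym : symmetric (S 3)) :
  inter_num S 1 2 ord0 = 5%N -> inter_num S 3 3 ord0 = 5%N ->
  inter_num S 1 2 1 = 1%N -> inter_num S 1 1 1 = 1%N -> inter_num S 3 3 1 = 2%N ->
  inter_num S 3 2 1 = 1%N -> inter_num S 1 3 3 = 2%N -> inter_num S 3 3 3 = 0%N ->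
  False.
Proof.
move=> k1E k3E p121E p111E p331E p321E p133E p333E.
have Sd x : S ord0 x x by rewrite scheme_diag.
have disj k l x y : k != l -> S k x y -> S l x y = false.
  by move=> kl kxy; rewrite (scheme_eq_rel _ kxy) eq_sym (negPf kl).
apply: (@no_orientation X (S 1) (S 3)) => //.
- by move=> x; rewrite (disj _ _ _ _ _ (Sd x)).
- by move=> x y xy; rewrite -R1_transpose (disj _ _ _ _ _ xy).
- by move=> x y xy; rewrite (disj _ _ _ _ _ xy).
- move=> x y; have [k] := scheme_cover S x y; move: k; apply: ord4P.
  + by rewrite scheme_diag => ->.
  + by move=> ->; rewrite orbT.
  + by rewrite R1_transpose => ->; rewrite !orbT.
  + by move=> ->; rewrite !orbT.
- move=> x; rewrite -[RHS]k1E -(scheme_inter 1 2 (Sd x)).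
  by apply: eq_card => z; rewrite !inE R1_transpose andbb.
- move=> x; rewrite -[RHS]k3E -(scheme_inter 3 3 (Sd x)).
  by apply: eq_card => z; rewrite !inE (R3_sym z) andbb.
- move=> x y xy; rewrite -[RHS]p121E -(scheme_inter 1 2 xy).
  by apply: eq_card => z; rewrite !inE R1_transpose.
- by move=> x y xy; rewrite -[RHS]p111E -(scheme_inter 1 1 xy).
- by move=> x y xy; rewrite -[RHS]p331E -(scheme_inter 3 3 xy).
- move=> x y xy; rewrite -[RHS]p321E -(scheme_inter 3 2 xy).
  by apply: eq_card => z; rewrite !inE R1_transpose.
- by move=> x y xy; rewrite -[RHS]p133E -(scheme_inter 1 3 xy).
- move=> x y z xy yz; apply/negP => xz; have := scheme_inter 3 3 xz.
  by rewrite p333E => /eqP; rewrite cards_eq0 => /eqP/setP/(_ y); rewrite !inE xy yz.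
- by have [x [y xy]] := scheme_nonempty S 1; exists x, y.
Qed.

Lemma hermitian_hadamard_scheme (C : numClosedFieldType) (X : finType)
    (S : assoc_scheme X 3) (w : 'I_4 -> C) (W : 'M[C]_#|X|)
    (S_comm : commutative_scheme S)
    (S_nonsym : ~ symmetric_scheme S)
    (R1_transpose : forall x y, S 2 x y = S 1 y x)
    (R3_sym : symmetric (S 3))
    (w0 : w 0 = 1)
    (w_abs : forall k, `|w k| = 1)
    (W_def : W = \sum_(k < 4) w k *: adj C S k)
    (W_herm : W \is hermsymmx)
    (W_hadamard : complex_hadamard W)
    (W_not_real : ~ real_hadamard W) :
  (exists a : nat,
     [/\ (0 < a)%N,
         ~ symmetric_scheme S,
         forall k, k != 0 -> (symmetric (S k) <-> k = 3),
         disjoint_cliques (S 3) (2 * a) (2 * a) &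
         exists E : 'I_4 -> 'M[C]_#|X|,
           primitive_idempotents S E /\
           first_eigenmatrix S E (eigenmatrix_cliques C a)]) /\
  (w 1 = 'i \/ w 1 = - 'i) /\ w 3 = 1.
Proof.
have w2E := w2_conj R1_transpose W_def W_herm.
have w12 := w12_eq1 R1_transpose w_abs W_def W_herm.
have w1n := w1_neq_w2 R1_transpose R3_sym w0 w_abs W_def W_herm W_hadamard W_not_real.
have [h1 h2 h3] := hadamard_eqs S_comm R1_transpose R3_sym w0 W_def W_herm W_hadamard.
have rows := row_sums S_comm R1_transpose R3_sym.
have tri := triangle_counts S_comm R1_transpose R3_sym.
have eig := eigenvalue_rel S_comm R1_transpose R3_sym.
have k1_gt0 : (0 < (inter_num S 1 2 ord0)%R)%N by apply: valency_gt0.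
have k3_gt0 : (0 < (inter_num S 3 3 ord0)%R)%N.
  by apply: valency_gt0 => x y; rewrite R3_sym.
have [w3E|w3E] := w3_sq R3_sym w_abs W_def W_herm; last first.
  have [[k1E k3E alE gaE deE] [epE zeE muE nuE siE]] :=
    weight3_eqN1 w2E w12 w1n k1_gt0 k3_gt0 rows tri eig h1 h2 h3 w3E.
  case: (no_scheme16 R1_transpose R3_sym k1E k3E _ alE zeE _ _ siE).
  - by rewrite (inter121 R1_transpose).
  - by rewrite (S_comm 3 2).
  - by case: rows => _ _ _ _; rewrite siE k3E; lia.
have [w12_0 [a [a_gt0 k3E k1E muE [siE rhoE zeE deE]]]] :=
  weight3_eq1 w12 w1n k1_gt0 k3_gt0 rows tri eig h1 h2 h3 w3E.
split; last first.
  (* Since w1 w2 = 1, multiplying w1 + w2 = 0 by w1 gives w1^2 + 1 = 0. *)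
  split=> //; have : w 1 ^+ 2 == 'i ^+ 2.
    rewrite sqrCi expr2 -addr_eq0 (_ : _ + 1 = w 1 * (w 1 + w 2)).
      by rewrite w12_0 mulr0.
    by rewrite mulrDr w12.
  by rewrite eqf_sqr => /orP[] /eqP; [left | right].
exists a; split=> //.
- have [x [y xy]] := scheme_nonempty S 1.
  have yx_false : S 1 y x = false by rewrite -R1_transpose (scheme_eq_rel _ xy).
  apply: ord4P => // _.
  + by split=> // sym; rewrite sym xy in yx_false.
  + by split=> // sym; rewrite -R1_transpose sym R1_transpose xy in yx_false.
- exact: (R3_cliques S_comm R1_transpose R3_sym a_gt0 k3E k1E zeE).
- exact: (clique_eigenmatrix C S_comm R1_transpose R3_sym a_gt0 k3E k1E muE
    siE rhoE zeE deE).
Qed.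

Theorem theorem3p2 (R : realType) (X : finType) (S : assoc_scheme X 3)
    (w : 'I_4 -> R[i]) (W : 'M[R[i]]_#|X|)
    (S_comm : commutative_scheme S)
    (S_nonsym : ~ symmetric_scheme S)
    (R1_transpose : forall x y, S 2 x y = S 1 y x)
    (R3_sym : symmetric (S 3))
    (w0 : w 0 = 1)
    (w_abs : forall k, `|w k| = 1)
    (W_def : W = \sum_(k < 4) w k *: adj R[i] S k)
    (W_herm : W \is hermsymmx)
    (W_hadamard : complex_hadamard W)
    (W_not_real : ~ real_hadamard W) :
  (exists a : nat,
     [/\ (0 < a)%N,
         ~ symmetric_scheme S,
         forall k, k != 0 -> (symmetric (S k) <-> k = 3),
         disjoint_cliques (S 3) (2 * a) (2 * a) &
         exists E : 'I_4 -> 'M[R[i]]_#|X|,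
           primitive_idempotents S E /\
           first_eigenmatrix S E (eigenmatrix_cliques R[i] a)]) /\
  (w 1 = 'i \/ w 1 = - 'i) /\ w 3 = 1.
Proof.
exact: (hermitian_hadamard_scheme S_comm S_nonsym R1_transpose R3_sym w0 w_abs
  W_def W_herm W_hadamard W_not_real).
Qed.
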